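(* Let $\Phi=\{f_1,\dots,f_n\}$ be a $C^2$ IFS on $[0,1]$ as in the context, satisfying the separation property (S) and the non-integrability property (U), and let $\nu=\nu_{\mathbf p}$ be a self-conformal measure of $\Phi$ for a strictly positive probability vector $\mathbf p$, with associated transfer operators $P_s$. Then there exist $C,\gamma,\epsilon,R>0$ and $0<\alpha<1$ such that for all $b\in\mathbb{R}$ with $|b|>R$, all $a\in\mathbb{R}$ with $|a|<\epsilon$, and all $n\in\mathbb{N}$, $$\left\|P_{a+ib}^{\,n}\right\|_{C^1}\le C\cdot|b|^{1+\gamma}\cdot\alpha^n ,$$ where $\|\cdot\|_{C^1}$ is the operator norm on $C^1([0,1])$ equipped with $\|\varphi\|_{C^1}=\|\varphi\|_\infty+\|\varphi'\|_\infty$.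
   Context: $\Phi=\{f_1,\dots,f_n\}$ is a finite set of $C^2$ maps $f_a:[0,1]\to[0,1]$ with $0<\inf_{a,x}|f_a'(x)|\le\rho:=\sup_{a}\|f_a'\|_\infty<1$, such that not all $f_a$ have the same fixed point, and whose attractor $K$ (the unique nonempty compact set with $K=\bigcup_a f_a(K)$) does not contain $0$ or $1$. Write $\mathcal A=\{1,\dots,n\}$; for a finite word $I=(i_1,\dots,i_m)$ over $\mathcal A$, $f_I=f_{i_1}\circ\cdots\circ f_{i_m}$ and $c(I,x)=-\log|f_I'(x)|$. $\nu_{\mathbf p}$ is the unique Borel probability measure with $\nu=\sum_a p_a f_a\nu$. Let $\tilde C$ denote a constant such that $\left|\frac{d}{dx}\log|f_w'|(x)\right|\le\tilde C$ for all finite words $w$ and all $x\in[0,1]$ (if $\sup_{f\in\Phi}\|f'\|_\infty<\frac12$, one may take $\tilde C=2\sup_{x\in[0,1],f\in\Phi}|f''(x)/f'(x)|$). (S) For every $1\le k\le n$ there is $i\in\{1,3\}$ such that $f_i([0,1])$, $f_{i+1}([0,1])$, $f_k([0,1])$ are pairwise disjoint; in particular $f_i([0,1])\cap f_{i+1}([0,1])=\emptyset$ for $i=1,3$. (U) There are $m,m'>0$ such that for $i=1,3$ and all $x\in[0,1]$, $m\le\left|\frac{d}{dx}\left(\log |f_i'|-\log|f_{i+1}'|\right)(x)\right|\le m'$, and moreover $m-2\tilde C\rho>0$. For $s\in\mathbb{C}$ with $|\Re s|$ small, the transfer operator $P_s:C^1([0,1])\to C^1([0,1])$ is $$P_s(g)(x)=\sum_{a\in\mathcal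 A}p_a\, e^{2\pi s\, c(a,x)}\,g(f_a(x)).$$ *)

(* Defs.v *)
From HB Require Import structures.
From mathcomp Require Import all_boot all_order all_algebra.
From mathcomp Require Import complex.
From mathcomp Require Import all_classical all_reals all_analysis.

Set Implicit Arguments.
Unset Strict Implicit.
Unset Printing Implicit Defensive.

Import Order.TTheory GRing.Theory Num.Theory.
Import numFieldNormedType.Exports.

Local Open Scope classical_set_scope.
Local Open Scope ring_scope.

(* Maps of the unit interval are functions R -> R (or R -> R[i]) of which only
   the restriction to [0,1] matters; none of the definitions below depends on
   the values taken outside [0,1]. *)

Definition I01 {R : realType} : set R := `[0, 1].

(* Derivatives of functions on [0,1], one-sided at 0 and 1. *)

Definition diff_quot {R : realType} (g : R -> R) (x y : R) : R :=
  (g y - g x) / (y - x).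

Definition derivable01 {R : realType} (g : R -> R) (x : R) : Prop :=
  cvg (diff_quot g x y @[y --> within I01 x^']).

Definition D01 {R : realType} (g : R -> R) (x : R) : R :=
  lim (diff_quot g x y @[y --> within I01 x^']).

Definition C1_01 {R : realType} (g : R -> R) : Prop :=
  {in I01, forall x, derivable01 g x} /\ {within I01, continuous (D01 g)}.

Definition C2_01 {R : realType} (g : R -> R) : Prop :=
  {in I01, forall x, derivable01 g x} /\ C1_01 (D01 g).

(* The Banach space C^1([0,1]) of complex-valued functions. The norms take
   values in \bar R, so that an unbounded quantity has norm +oo. *)

Definition ReF {R : realType} (g : R -> R[i]) (x : R) : R := complex.Re (g x).

Definition ImF {R : realType} (g : R -> R[i]) (x : R) : R := complex.Im (g x).

Definition C1c {R : realType} (g : R -> R[i]) : Prop :=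
  C1_01 (ReF g) /\ C1_01 (ImF g).

Definition D01c {R : realType} (g : R -> R[i]) (x : R) : R[i] :=
  Complex (D01 (ReF g) x) (D01 (ImF g) x).

Definition sup_norm {R : realType} (g : R -> R[i]) : \bar R :=
  ereal_sup [set (Normc.normc (g x))%:E | x in I01].

Definition C1_norm {R : realType} (g : R -> R[i]) : \bar R :=
  (sup_norm g + sup_norm (D01c g))%E.

Definition C1_opnorm {R : realType} (T : (R -> R[i]) -> R -> R[i]) : \bar R :=
  ereal_sup [set C1_norm (T g) | g in [set g | C1c g /\ (C1_norm g <= 1)%E]].

(* Iterated function systems. *)

Definition deriv_values {R : realType} {n : nat} (f : 'I_n -> R -> R) : set R :=
  [set r | exists a : 'I_n, exists2 x : R, I01 x & r = `|D01 (f a) x|].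

(* For a C^2 IFS with n > 0 the set deriv_values f is nonempty and bounded, so
   the real-valued sup and inf below are the true ones. *)
Definition rho {R : realType} {n : nat} (f : 'I_n -> R -> R) : R :=
  sup (deriv_values f).

Definition is_C2_IFS {R : realType} {n : nat} (f : 'I_n -> R -> R) : Prop :=
  [/\ forall a : 'I_n, f a @` I01 `<=` I01,
      forall a : 'I_n, C2_01 (f a),
      0 < inf (deriv_values f),
      rho f < 1 &
      ~ (exists2 x : R, I01 x & forall a : 'I_n, f a x = x)].

(* As the f a are contractions of [0,1], there is exactly one such K. *)
Definition is_attractor {R : realType} {n : nat} (f : 'I_n -> R -> R)
    (K : set R) : Prop :=
  [/\ K `<=` I01, K !=set0, compact K & K = \bigcup_(a in setT) (f a @` K)].

Fixpoint word_map {R : realType} {n : nat} (f : 'I_n -> R -> R)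
    (w : seq 'I_n) : R -> R :=
  if w is a :: w' then f a \o word_map f w' else id.

Definition cocycle {R : realType} {n : nat} (f : 'I_n -> R -> R)
    (w : seq 'I_n) (x : R) : R :=
  - ln `|D01 (word_map f w) x|.

Definition log_deriv {R : realType} (g : R -> R) (x : R) : R := ln `|D01 g x|.

Definition distortion_bound {R : realType} {n : nat} (f : 'I_n -> R -> R)
    (Ct : R) : Prop :=
  forall (w : seq 'I_n) (x : R), I01 x ->
    `|D01 (log_deriv (word_map f w)) x| <= Ct.

(* Letters are numbered from 0: letter hn i (for i < 4) stands for the map
   f_(i+1), so that the index set {1, 3} of (S) and (U) becomes {0, 2}. *)
Definition letter {n : nat} (hn : (4 <= n)%N) (i : nat) : 'I_n :=
  widen_ord hn (inord i : 'I_4).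

Definition disjoint_images {R : realType} {n : nat} (f : 'I_n -> R -> R)
    (a b : 'I_n) : Prop :=
  f a @` I01 `&` f b @` I01 = set0.

Definition separation {R : realType} {n : nat} (hn : (4 <= n)%N)
    (f : 'I_n -> R -> R) : Prop :=
  forall k : 'I_n, exists2 i : nat, i = 0%N \/ i = 2%N &
    [/\ disjoint_images f (letter hn i) (letter hn i.+1),
        disjoint_images f (letter hn i) k &
        disjoint_images f (letter hn i.+1) k].

Definition non_integrability {R : realType} {n : nat} (hn : (4 <= n)%N)
    (f : 'I_n -> R -> R) (Ct : R) : Prop :=
  exists m m' : R,
    [/\ 0 < m, 0 < m',
        forall (i : nat) (x : R), i = 0%N \/ i = 2%N -> I01 x ->
          m <= `|D01 (fun y => log_deriv (f (letter hn i)) y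
                               - log_deriv (f (letter hn i.+1)) y) x| <= m' &
        0 < m - 2 * Ct * rho f].

Definition positive_prob_vector {R : realType} {n : nat} (p : 'I_n -> R) :
    Prop :=
  (forall a : 'I_n, 0 < p a) /\ \sum_(a < n) p a = 1.

(* nu is a measure on the Borel sets of R carried by [0,1]; the push-forward of
   nu under f a : [0,1] -> [0,1] sends A to nu ([0,1] `&` f a @^-1` A). *)
Definition self_conformal {R : realType} {n : nat} (f : 'I_n -> R -> R)
    (p : 'I_n -> R) (nu : probability (measurableTypeR R) R) : Prop :=
  nu I01 = 1%E /\
  forall A : set R, measurable (A : set (measurableTypeR R)) ->
    nu A = (\sum_(a < n) (p a)%:E * nu (I01 `&` f a @^-1` A))%E.

(* Transfer operators. *)

Definition cexp {R : realType} (z : R[i]) : R[i] :=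
  Complex (expR (complex.Re z) * cos (complex.Im z))
          (expR (complex.Re z) * sin (complex.Im z)).

Definition transfer {R : realType} {n : nat} (f : 'I_n -> R -> R)
    (p : 'I_n -> R) (s : R[i]) (g : R -> R[i]) (x : R) : R[i] :=
  \sum_(a < n) (p a)%:C%C * cexp (s * (2 * pi * cocycle f [:: a] x)%:C%C)
               * g (f a x).

(* Main.v *)
(* Dolgopyat's method, run without the measure nu. Write s = a + ib and expand
   P_s^N over words of length N. A function h is carried along with a majorant H
   such that h and H vary by at most a factor exp(L |x - y|) relative to H, with
   L comparable to |b|. For two words t1, t2 that differ only in the letter
   applied first, (U) and the distortion bound make the phase difference of the
   two branches turn at speed comparable to |b|. So at one of any two points at
   distance about 1/|b| the triangle inequality for these branches is lossy, and
   subtracting half of that loss from the sum of the majorants gives the next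
   majorant H'.

   Instead of integrating against nu, one averages along the random walk
   x -> f_a x with probability p_a. Stopping the walk when the image of its word
   has size about 1/|b| and applying two letters with disjoint images (given by
   (S)) produces two points at distance about 1/|b|, one of which gains. As H
   is nearly constant at that scale, the mean of H'^2 after more than
   C log |b| steps is at most a constant less than 1 times that of H^2. Iterating,
   and using that h is also controlled in the exponential Lipschitz sense, bounds
   both the supremum and the derivative; the C log |b| extra steps and the
   perturbation |a| < epsilon cost a power of |b| and a factor absorbed by the
   contraction. *)
Require Import Defs.
From mathcomp Require Import all_boot all_order all_algebra.
From mathcomp Require Import complex.
From mathcomp Require Import all_classical all_reals all_analysis.
From mathcomp Require Import ring lra zify.

Set Implicit Arguments.
Unset Strict Implicit.
Unset Printing Implicit Defensive.

Import Order.TTheory GRing.Theory Num.Theory.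
Import numFieldNormedType.Exports.

Local Open Scope classical_set_scope.
Local Open Scope ring_scope.

(** * One-sided derivatives on the unit interval *)

(** Little-o form of derivability relative to [A]. Being free of division it makes sense at [y = x],
    so compositions need no separate case where the inner increment vanishes. *)
Definition hasD {R : realType} (A : set R) (g : R -> R) (x l : R) : Prop :=
  forall e : R, 0 < e -> exists2 d : R, 0 < d & forall y, A y -> `|y - x| < d ->
    `|g y - g x - l * (y - x)| <= e * `|y - x|.

Section Derivatives.
Variable R : realType.
Implicit Types (A B : set R) (g h : R -> R) (x y l : R).

Lemma hasD_diff_quot g x l :
  hasD I01 g x l <-> diff_quot g x y @[y --> within I01 x^'] --> l.
Proof.
split=> [H|/cvgrPdist_le H e e0].
  apply/cvgrPdist_le => e e0; have [d d0 Hd] := H e e0.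
  rewrite near_withinE near_withinE; apply/nbhs_ballP.
  exists d => // y; rewrite /ball /= => yd yx Iy.
  have {}Hd := Hd y Iy; rewrite /diff_quot distrC.
  have yx0 : y - x != 0 by rewrite subr_eq0.
  rewrite -(@mulfK _ (y - x) yx0 l) -mulrBl normrM normfV ler_pdivrMr ?normr_gt0//.
  by apply: Hd; rewrite distrC.
have := H e e0; rewrite near_withinE near_withinE => /nbhs_ballP[d /= d0 Hd].
exists d => // y Iy yd; have [->|yx] := eqVneq y x.
  by rewrite !subrr mulr0 subr0 normr0 mulr0.
have /= := Hd y; rewrite /ball /= distrC => /(_ yd yx Iy).
have yx0 : y - x != 0 by rewrite subr_eq0.
rewrite /diff_quot distrC -[X in _ - X](@mulfK _ (y - x) yx0 l) -mulrBl normrM normfV.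
by rewrite ler_pdivrMr ?normr_gt0//.
Qed.

(** Limits of one-sided difference quotients are unique because no point of [0,1] is isolated in it:
    from the left half there is room on the right, from the right half on the left. *)
Lemma within_I01_proper x : I01 x -> ProperFilter (within I01 x^').
Proof.
rewrite /I01 /= in_itv /= => /andP[x0 x1].
apply: Build_ProperFilter_ex => P; rewrite /within /= /dnbhs /within /=.
move=> /nbhs_ballP[d /= d0 Hd].
pose t := Num.min (d / 2) (1 / 2).
have t0 : 0 < t by rewrite /t lt_min; apply/andP; split; lra.
have td : t < d by rewrite /t gt_min; apply/orP; left; lra.
have t1 : t <= 1 / 2 by rewrite /t ge_min lexx orbT.
have [xh|xh] := leP x (1 / 2).
- exists (x + t); apply: Hd.
  + by rewrite /ball /= opprD addNKr normrN gtr0_norm.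
  + by rewrite -subr_eq0; apply/eqP; lra.
  + by rewrite /I01 /= in_itv /=; apply/andP; split; lra.
- exists (x - t); apply: Hd.
  + by rewrite /ball /= opprB addrC subrK gtr0_norm.
  + by rewrite -subr_eq0; apply/eqP; lra.
  + by rewrite /I01 /= in_itv /=; apply/andP; split; lra.
Qed.

Lemma hasD_D01 g x l : I01 x -> hasD I01 g x l -> D01 g x = l.
Proof.
move=> /within_I01_proper ? /hasD_diff_quot H; exact/cvg_lim.
Qed.

Lemma derivable01_hasD g x : derivable01 g x -> hasD I01 g x (D01 g x).
Proof. by move=> H; apply/hasD_diff_quot. Qed.

Lemma hasD_continuous A g x l : hasD A g x l ->
  forall e : R, 0 < e -> exists2 d : R, 0 < d & forall y, A y -> `|y - x| < d -> `|g y - g x| <= e.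
Proof.
move=> H e e0; have [d d0 Hd] := H 1 ltr01.
have c0 : 0 < 1 + `|l| by rewrite ltr_wpDr.
exists (Num.min d (e / (1 + `|l|))); first by rewrite lt_min d0 divr_gt0.
move=> y Ay; rewrite lt_min => /andP[yd ye].
have {}Hd := Hd y Ay yd.
have -> : g y - g x = (g y - g x - l * (y - x)) + l * (y - x) by rewrite subrK.
rewrite (le_trans (ler_normD _ _))// normrM.
rewrite (le_trans (lerD Hd (lexx _)))// -mulrDl mulrC -ler_pdivlMr//.
exact: ltW.
Qed.

Lemma hasD_comp A B g h x l l' : (forall y, A y -> B (h y)) ->
  hasD A h x l -> hasD B g (h x) l' -> hasD A (g \o h) x (l' * l).
Proof.
move=> hB Hh Hg e e0.
have c0 : 0 < 1 + `|l| + `|l'| by rewrite -addrA ltr_wpDr// addr_ge0.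
(* At accuracy [k <= 1] for both maps, the two errors add up to at most k(1 + |l| + |l'|)|y - x|. *)
pose k := Num.min 1 (e / (1 + `|l| + `|l'|)).
have k0 : 0 < k by rewrite lt_min ltr01 divr_gt0.
have k1 : k <= 1 by rewrite ge_min lexx.
have ke : k * (1 + `|l| + `|l'|) <= e by rewrite -ler_pdivlMr// ge_min lexx orbT.
have [d1 d10 Hd1] := Hg k k0.
have [d2 d20 Hd2] := Hh k k0.
have [d3 d30 Hd3] := hasD_continuous Hh (divr_gt0 d10 (ltr0Sn _ 1)).
exists (Num.min d2 d3); first by rewrite lt_min d20.
move=> y Ay; rewrite lt_min => /andP[y2 y3].
have {}Hd2 := Hd2 y Ay y2.
have {}Hd3 := Hd3 y Ay y3.
have {}Hd1 := Hd1 (h y) (hB _ Ay).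
have /Hd1 {}Hd1 : `|h y - h x| < d1 by rewrite (le_lt_trans Hd3)//; lra.
rewrite /= (_ : _ - _ = (g (h y) - g (h x) - l' * (h y - h x))
   + l' * (h y - h x - l * (y - x))); last by ring.
rewrite (le_trans (ler_normD _ _))// normrM.
have hyx : `|h y - h x| <= (1 + `|l|) * `|y - x|.
  rewrite -(subrK (l * (y - x)) (h y - h x)) (le_trans (ler_normD _ _))// normrM mulrDl.
  by rewrite lerD2r (le_trans Hd2)// ler_wpM2r.
apply: (le_trans (lerD (le_trans Hd1 (ler_wpM2l (ltW k0) hyx))
                       (ler_wpM2l (normr_ge0 l') Hd2))).
rewrite mulrA [`|l'| * _]mulrA -mulrDl ler_wpM2r//; nra.
Qed.

Lemma hasDD A g h x l l' : hasD A g x l -> hasD A h x l' ->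
  hasD A (fun y => g y + h y) x (l + l').
Proof.
move=> Hg Hh e e0; have e20 : 0 < e / 2 by lra.
have [d1 d10 H1] := Hg _ e20; have [d2 d20 H2] := Hh _ e20.
exists (Num.min d1 d2); first by rewrite lt_min d10.
move=> y Ay; rewrite lt_min => /andP[/(H1 y Ay) {}H1 /(H2 y Ay) {}H2].
rewrite (_ : _ - _ = (g y - g x - l * (y - x)) + (h y - h x - l' * (y - x))); last by ring.
rewrite (le_trans (ler_normD _ _))//; lra.
Qed.

Lemma hasDN A g x l : hasD A g x l -> hasD A (fun y => - g y) x (- l).
Proof.
move=> Hg e e0; have [d d0 H] := Hg e e0; exists d => // y Ay yd.
rewrite (_ : _ - _ = - (g y - g x - l * (y - x))); last by ring.
by rewrite normrN; exact: H.
Qed.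

Lemma hasDB A g h x l l' : hasD A g x l -> hasD A h x l' ->
  hasD A (fun y => g y - h y) x (l - l').
Proof. by move=> gl /hasDN; exact: hasDD. Qed.

Lemma hasD_id A x : hasD A id x 1.
Proof.
by move=> e e0; exists 1 => // y _ _; rewrite mul1r subrr normr0 mulr_ge0// ltW.
Qed.

Lemma hasD_eq A g h x l : A x -> (forall y, A y -> g y = h y) ->
  hasD A g x l -> hasD A h x l.
Proof.
move=> Ax gh Hg e e0; have [d d0 H] := Hg e e0; exists d => // y Ay.
by rewrite -!gh//; exact: H.
Qed.

Lemma hasD_is_derive A g x l : is_derive x 1 g l -> hasD A g x l.
Proof.
case=> [dg lg] e e0.
have /cvgrPdist_le/(_ e e0) : (fun k : R => k^-1 *: (g (k *: 1 + x) - g x)) @ 0^' --> l.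
  by rewrite -lg; exact: dg.
rewrite /dnbhs /within /= => /nbhs_ballP[d /= d0 Hd].
exists d => // y _ yd; have [->|yx] := eqVneq y x.
  by rewrite !subrr mulr0 subr0 normr0 mulr0.
have yx0 : y - x != 0 by rewrite subr_eq0.
have /= := Hd (y - x); rewrite /ball /= sub0r normrN => /(_ yd yx0).
rewrite [(y - x) *: 1](mulr1 (y - x)) subrK distrC [(y - x)^-1 *: _]mulrC.
rewrite -[X in _ - X](@mulfK _ (y - x) yx0 l) -mulrBl normrM normfV.
by rewrite ler_pdivrMr ?normr_gt0//.
Qed.

Lemma hasD_ln_norm t : t != 0 -> hasD setT (fun u : R => ln `|u|) t t^-1.
Proof.
wlog t0 : t / 0 < t.
  move=> W tn; have [/W|tlt] := ltP 0 t; first exact.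
  have nt0 : 0 < - t by rewrite oppr_gt0 lt_neqAle tn.
  have /= Wt := W _ nt0 (lt0r_neq0 nt0).
  move=> e e0; have [d d0 Hd] := Wt e e0; exists d => // y _ yd.
  have := Hd (- y) I; rewrite -opprD !normrN => /(_ yd).
  by rewrite invrN mulrNN.
move=> _ e e0.
have [d d0 Hd] := @hasD_is_derive setT _ _ _ (is_derive1_ln t0) e e0.
exists (Num.min d t); first by rewrite lt_min d0.
move=> y _; rewrite lt_min => /andP[yd yt].
have y0 : 0 < y by move: yt; rewrite ltr_norml => /andP[]; lra.
rewrite (gtr0_norm t0) (gtr0_norm y0); exact: (Hd y I yd).
Qed.

(** Strictly between [x] and [y] the derivative relative to [0,1] is two-sided, and at the two ends
    continuity is enough, so the mean value theorem on the line applies even when an end is 0 or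
    1. *)
Lemma MVT01 g dg : (forall x, I01 x -> hasD I01 g x (dg x)) ->
  forall x y, I01 x -> I01 y -> exists2 z : R, I01 z & g y - g x = dg z * (y - x).
Proof.
move=> H x y Ix Iy.
wlog xy : x y Ix Iy / x <= y.
  move=> W; have [/W|/ltW/W] := leP x y; first exact.
  move=> /(_ Iy Ix)[z Iz zE]; exists z => //.
  by rewrite -opprB zE -mulrN opprB.
move: (Ix) (Iy); rewrite /I01 /= !in_itv /= => /andP[x0 x1] /andP[y0 y1].
have II z : z \in `[x, y]%R -> I01 z.
  rewrite in_itv /= => /andP[xz zy]; rewrite /I01 /= in_itv /=; apply/andP; split; lra.
have dgE z : z \in `]x, y[%R -> is_derive z 1 g (dg z).
  move=> zxy; have Iz : I01 z by apply: II; apply: subset_itv_oo_cc.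
  have [r /= r0 Hr] : exists2 r : R, 0 < r & forall w : R, `|w - z| < r -> I01 w.
    have /nbhs_ballP[r r0 Hr] := near_in_itvoo zxy.
    exists r => // w wz; apply: II; apply: subset_itv_oo_cc; apply: Hr.
    by rewrite /ball /= distrC.
  have K : (fun k : R => k^-1 *: (g (k *: 1 + z) - g z)) @ 0^' --> dg z.
    apply/cvgrPdist_le => e e0; have [d d0 Hd] := H z Iz e e0.
    rewrite near_withinE; apply/nbhs_ballP.
    exists (Num.min r d); first by rewrite /= lt_min r0.
    move=> h; rewrite /ball /= sub0r normrN lt_min => /andP[hr hd] h0.
    rewrite [h *: 1]mulr1 distrC [h^-1 *: _]mulrC.
    rewrite -[X in _ - X](@mulfK _ h h0) -mulrBl normrM normfV ler_pdivrMr ?normr_gt0//.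
    by have := Hd (h + z); rewrite addrK; apply => //; apply: Hr; rewrite addrK.
  split; last exact/cvg_lim.
  by apply/cvg_ex; exists (dg z).
have gc : {within `[x, y], continuous g}.
  apply/subspace_continuousP => z zxy; apply/cvgrPdist_le => e e0.
  have [d d0 Hd] := hasD_continuous (H z (II z zxy)) e0.
  rewrite near_withinE; apply/nbhs_ballP; exists d => // w; rewrite /ball /= => wd wI.
  by rewrite distrC; apply: Hd; [exact: II|rewrite distrC].
by have [z /II zI zE] := MVT_segment xy dgE gc; exists z.
Qed.

Lemma MVT_D01 g : (forall x, I01 x -> exists l, hasD I01 g x l) ->
  forall x y, I01 x -> I01 y ->
    exists2 z : R, I01 z & g y - g x = D01 g z * (y - x).
Proof.
move=> H; apply: MVT01 => x Ix; have [l gl] := H x Ix.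
by rewrite (hasD_D01 Ix gl).
Qed.

(* No derivability is assumed: where the difference quotient diverges, [lim] is 0. *)
Lemma D01_le_lipschitz g x C d : I01 x -> 0 < d -> 0 <= C ->
  (forall y, I01 y -> `|y - x| < d -> `|g y - g x| <= C * `|y - x|) -> `|D01 g x| <= C.
Proof.
move=> Ix d0 C0 H; have := within_I01_proper Ix => FF.
have [cv|/dvgP] := pselect (derivable01 g x); last first.
  by rewrite /D01 => ->; rewrite normr0.
have nl : (`|diff_quot g x y| @[y --> within I01 x^']) --> `|D01 g x|.
  by apply: cvg_norm; exact: cv.
rewrite -(cvg_lim _ nl)//; apply: limr_le; first by apply/cvg_ex; exists `|D01 g x|.
rewrite near_withinE near_withinE; apply/nbhs_ballP; exists d => // y; rewrite /ball /= => yd yx Iy.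
have yx0 : 0 < `|y - x| by rewrite normr_gt0 subr_eq0.
by rewrite /diff_quot normrM normfV ler_pdivrMr//; apply: H; rewrite // distrC.
Qed.
End Derivatives.

(** * Distortion of an iterated function system *)

Section IFSData.
Variables (R : realType) (n : nat) (f : 'I_n -> R -> R) (Ct : R).
Hypotheses (hf : is_C2_IFS f) (hCt : distortion_bound f Ct).
Implicit Types (a : 'I_n) (u v w : seq 'I_n) (x y : R).

Let I0 : I01 (0 : R). Proof. by rewrite /I01 /= in_itv /= lexx ler01. Qed.

Lemma distortion_bound_ge0 : 0 <= Ct.
Proof. exact: le_trans (normr_ge0 _) (hCt [::] I0). Qed.

Lemma branch_I01 a x : I01 x -> I01 (f a x).
Proof. by case: hf => h _ _ _ _ Ix; apply: (h a); exists x. Qed.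

Lemma word_map_I01 w x : I01 x -> I01 (word_map f w x).
Proof. by move=> Ix; elim: w => //= a w IH; exact: branch_I01. Qed.

Lemma word_map_cat u v x : word_map f (u ++ v) x = word_map f u (word_map f v x).
Proof. by elim: u => //= a u ->. Qed.

Lemma branch_hasD a x : I01 x -> hasD I01 (f a) x (D01 (f a) x).
Proof.
case: hf => _ /(_ a)[h _] _ _ _ Ix.
by apply: derivable01_hasD; apply: h; rewrite inE.
Qed.

Lemma branch_hasD2 a x : I01 x -> hasD I01 (D01 (f a)) x (D01 (D01 (f a)) x).
Proof.
case: hf => _ /(_ a)[_ [h _]] _ _ _ Ix.
by apply: derivable01_hasD; apply: h; rewrite inE.
Qed.

Lemma word_map_hasD w x : I01 x -> hasD I01 (word_map f w) x (D01 (word_map f w) x).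
Proof.
move=> Ix; suff [l wl] : exists l, hasD I01 (word_map f w) x l by rewrite (hasD_D01 Ix wl).
elim: w => [|a w [l IH]] /=; first by exists 1; exact: hasD_id.
exists (D01 (f a) (word_map f w x) * l); apply: hasD_comp IH _; first exact: word_map_I01.
by apply: branch_hasD; exact: word_map_I01.
Qed.

Lemma D01_word_cons a w x : I01 x ->
  D01 (word_map f (a :: w)) x = D01 (f a) (word_map f w x) * D01 (word_map f w) x.
Proof.
move=> Ix; apply: (hasD_D01 Ix); apply: hasD_comp (word_map_hasD w Ix) _.
  exact: word_map_I01.
by apply: branch_hasD; exact: word_map_I01.
Qed.

Lemma inf_deriv_le a x : I01 x -> inf (deriv_values f) <= `|D01 (f a) x|.
Proof.
move=> Ix; apply: ge_inf; last by exists a, x.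
by exists 0 => _ [b [y _ ->]].
Qed.

Lemma branch_deriv_gt0 a x : I01 x -> 0 < `|D01 (f a) x|.
Proof. by move=> /(inf_deriv_le a); apply: lt_le_trans; case: hf. Qed.

Lemma word_deriv_gt0 w x : I01 x -> 0 < `|D01 (word_map f w) x|.
Proof.
move=> Ix; elim: w => [|a w IH].
  by rewrite (hasD_D01 Ix (@hasD_id _ I01 x)) normr1.
by rewrite D01_word_cons// normrM mulr_gt0//; apply/branch_deriv_gt0/word_map_I01.
Qed.

Lemma cocycle_nil x : I01 x -> cocycle f [::] x = 0.
Proof. by move=> Ix; rewrite /cocycle (hasD_D01 Ix (@hasD_id _ I01 x)) normr1 ln1 oppr0. Qed.

Lemma cocycle_cons a w x : I01 x ->
  cocycle f (a :: w) x = cocycle f w x + cocycle f [:: a] (word_map f w x).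
Proof.
move=> Ix; rewrite /cocycle D01_word_cons// normrM lnM ?opprD 1?addrC//;
  by rewrite posrE ?word_deriv_gt0// branch_deriv_gt0//; exact: word_map_I01.
Qed.

Lemma cocycle_cat u v x : I01 x ->
  cocycle f (u ++ v) x = cocycle f v x + cocycle f u (word_map f v x).
Proof.
move=> Ix; elim: u => [|a u IH] /=; first by rewrite cocycle_nil ?addr0//; exact: word_map_I01.
rewrite cocycle_cons// IH (cocycle_cons a u); last exact: word_map_I01.
by rewrite addrA word_map_cat.
Qed.

Lemma expRN_cocycle w x : I01 x -> expR (- cocycle f w x) = `|D01 (word_map f w) x|.
Proof. by move=> Ix; rewrite opprK lnK// posrE word_deriv_gt0. Qed.

(** [distortion_bound] constrains [D01], a limit with a default value; it yields a Lipschitz bound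
    only once the derivative is known to exist. Existence follows along the word by the chain rule,
    from the C^2 assumption and the nonvanishing of the derivatives. *)
Lemma log_deriv_hasD w x : I01 x -> exists l, hasD I01 (log_deriv (word_map f w)) x l.
Proof.
elim: w x => [|a w IH] x Ix.
  exists 0 => e e0; exists 1 => // y Iy _; rewrite /log_deriv.
  rewrite (hasD_D01 Ix (@hasD_id _ I01 x)) (hasD_D01 Iy (@hasD_id _ I01 y)).
  by rewrite subrr mul0r subr0 normr0 mulr_ge0// ltW.
have [l wl] := IH x Ix; have Iw := word_map_I01 w Ix.
exists ((D01 (f a) (word_map f w x))^-1 * (D01 (D01 (f a)) (word_map f w x)
   * D01 (word_map f w) x) + l).
apply: (@hasD_eq _ _ (fun y => log_deriv (f a) (word_map f w y) + log_deriv (word_map f w) y)) => //.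
  move=> y Iy; rewrite /log_deriv D01_word_cons// normrM lnM// posrE.
    by apply: branch_deriv_gt0; exact: word_map_I01.
  exact: word_deriv_gt0.
apply: hasDD => //; rewrite /log_deriv.
apply: (@hasD_comp _ I01 setT (fun t => ln `|t|) (D01 (f a) \o word_map f w)) => //.
  apply: (@hasD_comp _ _ I01) (branch_hasD2 _ Iw); last exact: word_map_hasD.
  exact: word_map_I01.
by apply: hasD_ln_norm; rewrite -normr_gt0; exact: branch_deriv_gt0.
Qed.

Lemma cocycle_lip w x y : I01 x -> I01 y ->
  `|cocycle f w x - cocycle f w y| <= Ct * `|x - y|.
Proof.
move=> Ix Iy; have [z Iz zE] := MVT_D01 (@log_deriv_hasD w) Ix Iy.
by rewrite /cocycle opprK addrC zE normrM distrC ler_wpM2r//; exact: hCt.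
Qed.

Lemma deriv_values_ub : has_ubound (deriv_values f).
Proof.
(* Distortion over length at most one compares each derivative with its value at 0; the sum over the
   letters dominates every one of them. *)
exists (\sum_(a < n) expR (Ct - cocycle f [:: a] 0)) => _ [a [x Ix ->]].
rewrite (bigD1 a)//= -[leLHS](expRN_cocycle [:: a])// -[leLHS]addr0 lerD//.
  rewrite ler_expR -lerBlDr; move: (cocycle_lip [:: a] I0 Ix) (Ix).
  rewrite sub0r normrN /I01 /= in_itv /= ler_norml => /andP[_ h] /andP[x0 x1].
  move: h; rewrite ger0_norm// => h; have := distortion_bound_ge0; nra.
by apply: sumr_ge0 => b _; exact: expR_ge0.
Qed.

Lemma deriv_le_rho a x : I01 x -> `|D01 (f a) x| <= rho f.
Proof. by move=> Ix; apply: ub_le_sup; [exact: deriv_values_ub|exists a, x]. Qed.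

Lemma branch_contract a x y : I01 x -> I01 y -> `|f a x - f a y| <= rho f * `|x - y|.
Proof.
move=> Ix Iy; have [z Iz ->] := MVT01 (@branch_hasD a) Iy Ix.
by rewrite normrM ler_wpM2r//; exact: deriv_le_rho.
Qed.

Lemma expRN_cocycle_letter_le a x : I01 x -> expR (- cocycle f [:: a] x) <= rho f.
Proof. by move=> Ix; rewrite expRN_cocycle//; exact: deriv_le_rho. Qed.

Lemma cocycle_letter_le a x : I01 x -> cocycle f [:: a] x <= - ln (inf (deriv_values f)).
Proof.
move=> Ix; rewrite lerN2 ler_ln ?inf_deriv_le// posrE ?branch_deriv_gt0//.
by case: hf.
Qed.

(** The mean value point and 0 are at distance at most one, so the derivatives there agree up to a
    factor [expR Ct]. The size of the image of [w] can thus be read off from the cocycle at the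
    single point 0. *)
Lemma word_map_distortion w x y : I01 x -> I01 y ->
  expR (- Ct) * expR (- cocycle f w 0) * `|x - y| <= `|word_map f w x - word_map f w y|
    <= expR Ct * expR (- cocycle f w 0) * `|x - y|.
Proof.
move=> Ix Iy; have [z Iz ->] := MVT01 (@word_map_hasD w) Iy Ix.
rewrite normrM -expRN_cocycle// -!expRD.
have := cocycle_lip w Iz I0; rewrite subr0.
move: (Iz); rewrite /I01 /= in_itv /= => /andP[z0 z1].
rewrite (ger0_norm z0) => h.
have {}h : `|cocycle f w z - cocycle f w 0| <= Ct.
  by rewrite (le_trans h)// ler_piMr// distortion_bound_ge0.
move: h; rewrite ler_norml => /andP[h1 h2].
by rewrite !ler_wpM2r// ler_expR; lra.
Qed.

End IFSData.

Local Notation nc := (@Normc.normc _).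

(** * Estimates on complex numbers *)

Section ComplexExponential.
Variable R : realType.
Implicit Types (z w : R[i]) (x y t : R).

Lemma nc_ge0 z : 0 <= nc z.
Proof. by case: z => x y /=; exact: sqrtr_ge0. Qed.

Lemma ncD z w : nc (z + w) <= nc z + nc w.
Proof. exact: le_normcD. Qed.

Lemma ncN z : nc (- z) = nc z.
Proof. exact: normcN. Qed.

Lemma ncB_sym z w : nc (z - w) = nc (w - z).
Proof. by rewrite -ncN opprB. Qed.

Lemma ncB_le z w : nc z - nc w <= nc (z - w).
Proof. by rewrite lerBlDr -{1}(subrK w z) ncD. Qed.

Lemma nc_dist z w : `|nc z - nc w| <= nc (z - w).
Proof. by rewrite ler_norml ncB_le lerNl opprB ncB_sym ncB_le. Qed.

Lemma ncM z w : nc (z * w) = nc z * nc w.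
Proof. exact: Normc.normcM. Qed.

Lemma nc_real x : nc (x%:C%C : R[i]) = `|x|.
Proof. by rewrite /= expr0n /= addr0 sqrtr_sqr. Qed.

Lemma nc_sum (I : finType) (P : pred I) (F : I -> R[i]) :
  nc (\sum_(i | P i) F i) <= \sum_(i | P i) nc (F i).
Proof.
elim/big_ind2: _ => [|z x w y zx wy|//]; first by rewrite Normc.normc0.
by rewrite (le_trans (ncD _ _))// lerD.
Qed.

Lemma nc_sqr x y : nc (Complex x y) ^+ 2 = x ^+ 2 + y ^+ 2.
Proof. by rewrite /= sqr_sqrtr// addr_ge0// sqr_ge0. Qed.

Lemma norm_Re_le z : `|complex.Re z| <= nc z.
Proof.
case: z => x y; rewrite -(ler_sqr (normr_ge0 _) (nc_ge0 _)) nc_sqr real_normK ?num_real//=.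
by rewrite lerDl sqr_ge0.
Qed.

Lemma norm_Im_le z : `|complex.Im z| <= nc z.
Proof.
case: z => x y; rewrite -(ler_sqr (normr_ge0 _) (nc_ge0 _)) nc_sqr real_normK ?num_real//=.
by rewrite lerDr sqr_ge0.
Qed.

Lemma nc_le_ReIm z : nc z <= `|complex.Re z| + `|complex.Im z|.
Proof.
case: z => x y; rewrite -(ler_sqr (nc_ge0 _)) ?nnegrE ?addr_ge0// nc_sqr/= sqrrD.
rewrite !real_normK ?num_real// addrAC lerDl; exact/mulrn_wge0/mulr_ge0.
Qed.

Lemma cexpD z w : cexp (z + w) = cexp z * cexp w.
Proof.
case: z w => [a b] [c d]; rewrite /cexp /= expRD cosD sinD.
by congr Complex; rewrite /=; ring.
Qed.

Lemma realcD x y : ((x + y)%:C)%C = (x%:C)%C + (y%:C)%C :> R[i].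
Proof. exact: raddfD. Qed.

Lemma realcM x y : ((x * y)%:C)%C = (x%:C)%C * (y%:C)%C :> R[i].
Proof. exact: rmorphM. Qed.

Lemma cexp0 : cexp 0 = 1 :> R[i].
Proof. by rewrite /cexp /= expR0 cos0 sin0 mulr1 mulr0. Qed.

Lemma nc_cexp z : nc (cexp z) = expR (complex.Re z).
Proof.
rewrite /cexp; apply/eqP; rewrite -(@eqrXn2 _ 2) ?nc_ge0 ?expR_ge0//.
by rewrite nc_sqr !exprMn -mulrDr cos2Dsin2 mulr1.
Qed.

Lemma sin_MVT t : exists2 c : R, `|c| <= `|t| & sin t = cos c * t.
Proof.
wlog t0 : t / 0 <= t.
  move=> W; have [/W//|/ltW tn] := leP 0 t.
  have [|c ct] := W (- t); first by rewrite oppr_ge0.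
  by rewrite sinN mulrN => /oppr_inj e; exists c; rewrite -1?(normrN t).
have [c] := @MVT_segment R sin cos 0 t t0 (fun x _ => is_derive_sin x)
   (continuous_subspaceT (@continuous_sin R)).
rewrite in_itv /= sin0 !subr0 => /andP[c0 ct] e.
by exists c => //; rewrite !ger0_norm.
Qed.

Lemma norm_sin_le t : `|sin t| <= `|t|.
Proof.
by have [c _ ->] := sin_MVT t; rewrite normrM ler_piMl// cos_max.
Qed.

Lemma one_sub_cosE t : 1 - cos t = 2 * sin (t / 2) ^+ 2.
Proof.
have -> : cos t = cos ((t / 2) *+ 2) by rewrite -mulr_natr divfK.
by rewrite cos_mulr2n cos2sin2; ring.
Qed.

Lemma norm_sin_ge t : `|t| <= 1 -> `|t| / 2 <= `|sin t|.
Proof.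
move=> t1; have [c ct ->] := sin_MVT t.
rewrite normrM mulrC ler_wpM2r// (le_trans _ (ler_norm _))//.
suff : 1 - cos c <= 1 / 2 by lra.
rewrite one_sub_cosE; have := norm_sin_le (c / 2).
rewrite normrM (gtr0_norm (_ : 0 < 2^-1)) ?invr_gt0// => h.
have {}h : `|sin (c / 2)| <= 1 / 2 by lra.
by rewrite -real_normK ?num_real//; have := normr_ge0 (sin (c / 2)); nra.
Qed.

Lemma cexp_i_sub1_le t : nc (cexp (Complex 0 t) - 1) <= `|t|.
Proof.
rewrite -(ler_sqr (nc_ge0 _) (normr_ge0 _)).
have -> : cexp (Complex 0 t) - 1 = Complex (cos t - 1) (sin t).
  by rewrite /cexp /= expR0 !mul1r; congr Complex; rewrite /= oppr0 addr0.
rewrite nc_sqr (_ : _ + _ = 2 * (1 - cos t)); last first.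
  by rewrite sin2cos2; ring.
rewrite one_sub_cosE; have := norm_sin_le (t / 2).
rewrite normrM (gtr0_norm (_ : 0 < 2^-1)) ?invr_gt0// => h.
rewrite -[sin _ ^+ 2]real_normK ?num_real//.
by have := normr_ge0 (sin (t / 2)); nra.
Qed.

Lemma cexp_i_sub1_ge t : `|t| <= 1 -> `|t| / 2 <= nc (cexp (Complex 0 t) - 1).
Proof.
move=> /norm_sin_ge h; rewrite (le_trans h)// (le_trans _ (norm_Im_le _))//.
by rewrite /cexp /= expR0 mul1r oppr0 addr0.
Qed.

Lemma cexp_i_mulB (p q r t : R) :
  cexp (Complex 0 p) * cexp (Complex 0 q) - cexp (Complex 0 r) * cexp (Complex 0 t) =
  cexp (Complex 0 r) * cexp (Complex 0 t) * (cexp (Complex 0 (p + q - r - t)) - 1).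
Proof.
rewrite mulrBr mulr1 -!cexpD; congr (cexp _ - _).
by apply/eqP; rewrite eq_complex /= !addr0 eqxx /=; apply/eqP; ring.
Qed.

Lemma cexp_sub1_le x y : nc (cexp (Complex x y) - 1) <= expR (`|x| + `|y|) - 1.
Proof.
have -> : cexp (Complex x y) - 1 =
    (expR x)%:C%C * (cexp (Complex 0 y) - 1) + (expR x - 1)%:C%C :> R[i].
  by rewrite /cexp /= expR0; apply/eqP; rewrite eq_complex /=; apply/andP; split; apply/eqP; ring.
rewrite (le_trans (ncD _ _))// ncM !nc_real ger0_norm ?expR_ge0//.
have xe : expR x <= expR `|x| by rewrite ler_expR ler_norm.
have x1 : `|expR x - 1| <= expR `|x| - 1.
  have [x0|x0] := leP 0 x.
    rewrite ger0_norm// ?subr_ge0 -?expR0 ?ler_expR//; lra.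
  rewrite ltr0_norm; last by rewrite subr_lt0 -expR0 ltr_expR.
  rewrite ltr0_norm// opprB lerBlDr expRN.
  have e0 := expR_gt0 x; have ei : expR x * (expR x)^-1 = 1 by rewrite divff ?gt_eqF.
  have := sqr_ge0 (expR x - 1); nra.
have := cexp_i_sub1_le y; have y1 := expR_ge1Dx `|y|.
have e1 := expR_gt0 `|x|; have ex := expR_gt0 x; have := nc_ge0 (cexp (Complex 0 y) - 1).
rewrite expRD; nra.
Qed.

(** By the identity (e^u - 1)e^v + (e^v - 1) = e^(u+v) - 1, Lipschitz exponents add under products
    without any multiplicative constant. *)
Lemma nc_mul_sub (X Y h k : R[i]) (q H u v : R) : 0 <= u ->
  nc X <= q -> nc (X - Y) <= (expR u - 1) * q ->
  nc h <= H -> nc (h - k) <= (expR v - 1) * H ->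
  nc (X * h - Y * k) <= (expR (u + v) - 1) * (q * H).
Proof.
move=> u0 Xq XY hH hk.
have -> : X * h - Y * k = (X - Y) * k + X * (h - k) by ring.
have q0 : 0 <= q := le_trans (nc_ge0 _) Xq.
have H0 : 0 <= H := le_trans (nc_ge0 _) hH.
have kH : nc k <= expR v * H.
  rewrite -(subrK h k) (le_trans (ncD _ _))// ncB_sym; lra.
rewrite (le_trans (ncD _ _))// !ncM expRD.
have u1 : 0 <= expR u - 1 by have := expR_ge1Dx u; lra.
have := ler_pM (nc_ge0 _) (nc_ge0 _) XY kH.
have := ler_pM (nc_ge0 _) (nc_ge0 _) Xq hk.
lra.
Qed.

Lemma expR_le1D2x x : 0 <= x <= 1 / 2 -> expR x <= 1 + 2 * x.
Proof.
move=> /andP[x0 x1]; have := expR_ge1Dx (- x); rewrite expRN => h.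
have e0 := expR_gt0 x; have ei : expR x * (expR x)^-1 = 1 by rewrite divff ?gt_eqF.
have {}h : expR x * (1 - x) <= 1 by rewrite -[leRHS]ei ler_wpM2l// ltW.
have k : 1 <= (1 + 2 * x) * (1 - x) by nra.
have x2 : 0 < 1 - x by lra.
by rewrite -(ler_pM2r x2); lra.
Qed.

Lemma nc_ratio_sub (h k : R[i]) (H K E : R) : 0 < H -> 0 < K -> nc k <= K ->
  nc (h - k) <= E * H -> `|H - K| <= E * H ->
  nc ((H^-1)%:C%C * h - (K^-1)%:C%C * k) <= 2 * E.
Proof.
move=> H0 K0 kK hk HK.
have -> : (H^-1)%:C%C * h - (K^-1)%:C%C * k =
   (H^-1)%:C%C * (h - k) + (H^-1 - K^-1)%:C%C * k by rewrite raddfB /=; ring.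
rewrite (le_trans (ncD _ _))// !ncM !nc_real.
rewrite (_ : 2 * E = E + E); last by ring.
apply: lerD.
  by rewrite gtr0_norm ?invr_gt0// mulrC ler_pdivrMr.
have -> : H^-1 - K^-1 = (K - H) / (H * K).
  by field; rewrite !gt_eqF.
rewrite normrM normfV [`|K - H|]distrC [`|H * K|]gtr0_norm ?mulr_gt0//.
rewrite mulrAC ler_pdivrMr ?mulr_gt0// mulrA ler_pM ?nc_ge0//.
Qed.

(** A small loss forces the inner product of [z] and [w] to be nearly [A * B], so the normalized
    numbers lie at squared distance at most 4q^2. *)
Lemma almost_aligned (z w : R[i]) (A B q : R) : 0 < A -> 0 < B -> 0 <= q <= 1 ->
  nc z <= A -> nc w <= B ->
  A + B - nc (z + w) < q ^+ 2 * A -> A + B - nc (z + w) < q ^+ 2 * B ->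
  nc ((A^-1)%:C%C * z - (B^-1)%:C%C * w) <= 2 * q /\
  1 - q ^+ 2 <= nc ((A^-1)%:C%C * z).
Proof.
move=> A0 B0 /andP[q0 q1] zA wB gA gB; split; last first.
  rewrite ncM nc_real gtr0_norm ?invr_gt0// mulrC ler_pdivlMr//.
  by have := ncD z w; lra.
have k0 : 0 <= q ^+ 2 := sqr_ge0 q.
have k1 : q ^+ 2 <= 1 by rewrite exprn_ile1.
(* With g the loss, (A + B)^2 - |z + w|^2 is at most 2gA + 2gB; the bound of g by q^2 B serves the
   first term, the bound by q^2 A the second. *)
have n2 : (A + B) ^+ 2 - 4 * q ^+ 2 * A * B <= nc (z + w) ^+ 2.
  have := nc_ge0 (z + w); have := ncD z w.
  move: gA gB; set N := nc (z + w); set k := q ^+ 2 in k0 k1 * => gA gB ND N0.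
  have g0 : 0 <= A + B - N by lra.
  by have := sqr_ge0 (A + B - N); nra.
have zA2 : nc z ^+ 2 <= A ^+ 2 by rewrite lerXn2r ?nnegrE ?nc_ge0// ltW.
have wB2 : nc w ^+ 2 <= B ^+ 2 by rewrite lerXn2r ?nnegrE ?nc_ge0// ltW.
rewrite -(ler_sqr (nc_ge0 _)) ?nnegrE; last by lra.
case: z w {zA wB gA gB} n2 zA2 wB2 => [a b] [c d].
have -> : Complex a b + Complex c d = Complex (a + c) (b + d) by [].
have -> : (A^-1)%:C%C * Complex a b - (B^-1)%:C%C * Complex c d =
   Complex (a / A - c / B) (b / A - d / B).
  by congr Complex; rewrite /=; ring.
rewrite !nc_sqr => n2 zA2 wB2.
have -> : (a / A - c / B) ^+ 2 + (b / A - d / B) ^+ 2 =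
   ((a ^+ 2 + b ^+ 2) * B ^+ 2 + (c ^+ 2 + d ^+ 2) * A ^+ 2
    - 2 * (a * c + b * d) * (A * B)) / (A * B) ^+ 2.
  by field; rewrite !gt_eqF.
have AB : 0 < A * B by exact: mulr_gt0.
rewrite ler_pdivrMr ?exprn_gt0//.
have P : 2 * A * B - 4 * q ^+ 2 * A * B <= 2 * (a * c + b * d) by lra.
have h1 : (a ^+ 2 + b ^+ 2) * B ^+ 2 <= A ^+ 2 * B ^+ 2 by rewrite ler_wpM2r ?sqr_ge0.
have h2 : (c ^+ 2 + d ^+ 2) * A ^+ 2 <= B ^+ 2 * A ^+ 2 by rewrite ler_wpM2r ?sqr_ge0.
have h3 : (2 * A * B - 4 * q ^+ 2 * A * B) * (A * B) <= 2 * (a * c + b * d) * (A * B).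
  by rewrite ler_wpM2r// ltW.
lra.
Qed.

(** Cross-multiplying the two near equalities eliminates [g2] and [k2] up to [t] and leaves the
    difference of the phases times [g1], which is bounded away from 0. Two aligned pairs therefore
    have nearly equal relative phases. *)
Lemma phase_rigidity (e1 e2 d1 d2 g1 g2 k1 k2 : R[i]) (q t : R) :
  nc e1 = 1 -> nc e2 = 1 -> nc d1 = 1 -> nc d2 = 1 ->
  nc (e1 * g1 - e2 * g2) <= 2 * q -> nc (d1 * k1 - d2 * k2) <= 2 * q ->
  nc (g1 - k1) <= t -> nc (g2 - k2) <= t -> 1 / 2 <= nc g1 ->
  nc (e1 * d2 - d1 * e2) <= 8 * q + 4 * t.
Proof.
move=> E1 E2 D1 D2 eg dk gk1 gk2 g12.
have : nc ((e1 * d2 - d1 * e2) * g1) <= 4 * q + 2 * t.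
  have -> : (e1 * d2 - d1 * e2) * g1 =
     (d2 * (e1 * g1 - e2 * g2) + e2 * d2 * (g2 - k2))
      - (e2 * (d1 * k1 - d2 * k2) + e2 * d1 * (g1 - k1)) by ring.
  apply: le_trans (ncD _ _) _; rewrite ncN.
  apply: le_trans (lerD (ncD _ _) (ncD _ _)) _.
  rewrite !ncM E2 D1 D2 !mul1r; lra.
rewrite ncM; have := nc_ge0 (e1 * d2 - d1 * e2); nra.
Qed.

(** After cancellation, half of [A1 + A2] and half of the modulus remain, each varying by at most
    half of [E * (A1 + A2)]. Subtracting half the loss thus does not increase the variation. *)
Lemma lip_half_cancel (z1 z2 w1 w2 : R[i]) (A1 A2 B1 B2 r1 r2 E : R) :
  nc (z1 - w1) <= E * A1 -> nc (z2 - w2) <= E * A2 ->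
  `|A1 - B1| <= E * A1 -> `|A2 - B2| <= E * A2 -> `|r1 - r2| <= E * r1 ->
  `|(A1 + A2 + r1 - (A1 + A2 - nc (z1 + z2)) / 2)
    - (B1 + B2 + r2 - (B1 + B2 - nc (w1 + w2)) / 2)| <= E * (A1 + A2 + r1).
Proof.
have := nc_dist (z1 + z2) (w1 + w2).
have := ncD (z1 - w1) (z2 - w2); rewrite addrACA -opprD.
move: (nc (z1 + z2 - (w1 + w2))) (nc (z1 + z2)) (nc (w1 + w2)) => n3 n4 n5.
move: (nc (z1 - w1)) (nc (z2 - w2)) => n1 n2.
rewrite !ler_norml => ? /andP[? ?] ? ? /andP[? ?] /andP[? ?] /andP[? ?].
by apply/andP; split; lra.
Qed.

(** The relative phase turns by an angle of at most 1, so the chord is at least half the angle;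
    since pi >= 2, it is at least 2m|b|d. One half of this beats [8 * q], the other covers
    [16 * u]. *)
Lemma phase_gap (b m C d q u c1 c2 c1' c2' : R) : 0 <= C -> 0 <= d ->
  m * d <= `|(c1 - c2) - (c1' - c2')| ->
  `|c1 - c1'| <= C * d -> `|c2 - c2'| <= C * d ->
  4 * pi * C * (`|b| * d) <= 1 ->
  16 * u <= m * `|b| * d -> 8 * q < m * `|b| * d -> 0 <= q ->
  8 * q + 4 * (4 * u) <
  nc (cexp (Complex 0 (2 * pi * b * c1)) * cexp (Complex 0 (2 * pi * b * c2'))
    - cexp (Complex 0 (2 * pi * b * c1')) * cexp (Complex 0 (2 * pi * b * c2))).
Proof.
move=> C0 d0 md cl1 cl2 cb um mb q0.
rewrite cexp_i_mulB !ncM !nc_cexp expR0 !mul1r.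
rewrite (_ : _ - 2 * pi * b * c2 = 2 * pi * b * ((c1 - c2) - (c1' - c2'))); last by ring.
set ps := 2 * pi * b * _.
have psE : `|ps| = 2 * pi * `|b| * `|(c1 - c2) - (c1' - c2')|.
  by rewrite !normrM (ger0_norm (pi_ge0 R)) (ger0_norm (ler0n R 2)).
have pb0 : 0 <= 2 * pi * `|b| by rewrite !mulr_ge0 ?pi_ge0.
have ps1 : `|ps| <= 1.
  rewrite psE; apply: le_trans cb.
  rewrite (_ : 4 * _ * _ * _ = 2 * pi * `|b| * (2 * (C * d))); last by ring.
  rewrite ler_wpM2l//; move: cl1 cl2.
  by rewrite !ler_norml => /andP[? ?] /andP[? ?]; apply/andP; split; lra.
apply: lt_le_trans (cexp_i_sub1_ge ps1).
have : 2 * pi * `|b| * (m * d) <= `|ps| by rewrite psE ler_wpM2l.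
have pi2 := pi_ge2 R.
have : 2 * (m * `|b| * d) <= pi * (m * `|b| * d) by rewrite ler_wpM2r//; lra.
move: pi (`|ps|) => P S; lra.
Qed.
End ComplexExponential.

(** * Word expansions and cones *)

Section WeightedOperator.
Variables (K : comNzRingType) (R : realType) (n : nat).
Implicit Types (k : 'I_n -> R -> K) (f : 'I_n -> R -> R) (g : R -> K).

(** Common form of the real averaging operator [walk] and the complex [transfer], so that the
    expansion over words is proved once. *)
Definition wop k f g (x : R) : K := \sum_(a < n) k a x * g (f a x).

Fixpoint word_weight k f (w : seq 'I_n) (x : R) : K :=
  if w is a :: w' then word_weight k f w' x * k a (word_map f w' x) else 1.

Lemma sum_tuple_cons m (F : seq 'I_n -> K) :
  \sum_(w : m.+1.-tuple 'I_n) F w = \sum_(w : m.-tuple 'I_n) \sum_(a < n) F (a :: w).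
Proof.
rewrite exchange_big pair_big /=.
rewrite (reindex (fun q : 'I_n * m.-tuple 'I_n => [tuple of q.1 :: q.2])) //=.
exists (fun t : m.+1.-tuple 'I_n => (thead t, [tuple of behead t])) => /= [[a w] _|t _].
  by congr pair; apply: val_inj.
by rewrite [in RHS](tuple_eta t).
Qed.

Lemma iter_wop k f N g x : iter N (wop k f) g x =
  \sum_(w : N.-tuple 'I_n) word_weight k f w x * g (word_map f w x).
Proof.
elim: N g => [|N IH] g.
  rewrite (bigD1 [tuple])//= mul1r big1 ?addr0// => w; by rewrite (tuple0 w) => /eqP.
rewrite iterSr IH (sum_tuple_cons _ (fun w => word_weight k f w x * g (word_map f w x))).
apply: eq_bigr => w _; rewrite /wop mulr_sumr; apply: eq_bigr => a _ /=.
by rewrite mulrA.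
Qed.
End WeightedOperator.

Section Words.
Variables (R : realType) (n : nat) (f : 'I_n -> R -> R) (Ct : R).
Hypotheses (hf : is_C2_IFS f) (hCt : distortion_bound f Ct).
Variable p : 'I_n -> R.
Hypothesis hp : positive_prob_vector p.
Implicit Types (L : R) (w u v : seq 'I_n) (x y : R) (s : R[i]) (h : R -> R[i]) (H : R -> R).

Definition walk (G : R -> R) (x : R) : R := \sum_(a < n) p a * G (f a x).

Definition word_prob w : R := \prod_(a <- w) p a.

Definition word_factor s w x : R[i] :=
  (word_prob w)%:C%C * cexp (s * (2 * pi * cocycle f w x)%:C%C).

Lemma word_prob_gt0 w : 0 < word_prob w.
Proof. by case: hp => p0 _; apply: prodr_gt0. Qed.

Lemma iter_walk N G x :
  iter N walk G x = \sum_(w : N.-tuple 'I_n) word_prob w * G (word_map f w x).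
Proof.
rewrite (_ : walk = wop (fun a _ => p a) f)// iter_wop; apply: eq_bigr => w _.
congr (_ * _); elim: {w}(tval w) => [|a w IH] /=; first by rewrite /word_prob big_nil.
by rewrite IH /word_prob big_cons mulrC.
Qed.

Lemma iter_transfer s N h x : I01 x ->
  iter N (transfer f p s) h x =
  \sum_(w : N.-tuple 'I_n) word_factor s w x * h (word_map f w x).
Proof.
move=> Ix.
pose k a (x : R) := (p a)%:C%C * cexp (s * (2 * pi * cocycle f [:: a] x)%:C%C).
rewrite (_ : transfer f p s = wop k f)// iter_wop; apply: eq_bigr => w _.
congr (_ * _).
elim: {w}(tval w) => [|a w IH] /=.
  by rewrite /word_factor /word_prob big_nil cocycle_nil// mulr0 mulr0 cexp0 mulr1.
rewrite IH /k /word_factor /word_prob big_cons (cocycle_cons hf a w Ix).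
rewrite [2 * pi * (_ + _)]mulrDr realcD [s * (_ + _)]mulrDr cexpD realcM; ring.
Qed.

Lemma sum_word_prob N : \sum_(w : N.-tuple 'I_n) word_prob w = 1.
Proof.
have -> : \sum_(w : N.-tuple 'I_n) word_prob w = iter N walk (fun=> 1) 0.
  by rewrite iter_walk; apply: eq_bigr => w _; rewrite mulr1.
elim: N => [//|N IH]; rewrite iterSr -[RHS]IH; congr (iter N walk _ _).
apply/funext => x; case: (hp) => _ p1.
by rewrite -[RHS]p1; apply: eq_bigr => a _ /=; rewrite mulr1.
Qed.

Lemma walk_le N G1 G2 x : I01 x -> (forall y, I01 y -> G1 y <= G2 y) ->
  iter N walk G1 x <= iter N walk G2 x.
Proof.
move=> Ix G12; rewrite !iter_walk; apply: ler_sum => w _.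
by rewrite ler_wpM2l ?G12 ?ltW ?word_prob_gt0//; exact: word_map_I01.
Qed.

Lemma walkZ N k G x : iter N walk (fun y => k * G y) x = k * iter N walk G x.
Proof. by rewrite !iter_walk mulr_sumr; apply: eq_bigr => w _; ring. Qed.

Lemma iter_walkSr N G x : iter N.+1 walk G x =
  \sum_(a < n) p a * iter N walk (G \o f a) x.
Proof.
rewrite iterSr !iter_walk.
under [RHS]eq_bigr do rewrite iter_walk mulr_sumr.
rewrite exchange_big /=; apply: eq_bigr => w _; rewrite /walk mulr_sumr.
by apply: eq_bigr => a _ /=; ring.
Qed.

(** Jensen's inequality, obtained from the nonnegativity of the variance along the walk. *)
Lemma iter_walk_sqr N G x :
  (iter N walk G x) ^+ 2 <= iter N walk (fun y => G y ^+ 2) x.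
Proof.
pose t := iter N walk G x.
have : 0 <= \sum_(w : N.-tuple 'I_n) word_prob w * (G (word_map f w x) - t) ^+ 2.
  by apply: sumr_ge0 => w _; rewrite mulr_ge0 ?sqr_ge0// ltW// word_prob_gt0.
have -> : \sum_(w : N.-tuple 'I_n) word_prob w * (G (word_map f w x) - t) ^+ 2 =
   iter N walk (fun y => G y ^+ 2) x - 2 * t * iter N walk G x
   + t ^+ 2 * \sum_(w : N.-tuple 'I_n) word_prob w.
  rewrite !iter_walk !mulr_sumr -sumrB -big_split /=.
  by apply: eq_bigr => w _; ring.
rewrite sum_word_prob -/t; nra.
Qed.

Lemma rho_ge0 : 0 <= rho f.
Proof.
case: (hp) => _ p1; have [a|n0] := pickP 'I_n.
  have I0 : I01 (0 : R) by rewrite /I01 /= in_itv /= lexx ler01.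
  by rewrite (le_trans _ (deriv_le_rho hf hCt a I0)).
by move: p1; rewrite big_pred0// => /eqP; rewrite eq_sym oner_eq0.
Qed.

Lemma rho_lt1 : rho f < 1. Proof. by case: hf. Qed.

Lemma word_map_contract w x y : I01 x -> I01 y ->
  `|word_map f w x - word_map f w y| <= rho f ^+ size w * `|x - y|.
Proof.
move=> Ix Iy; elim: w => [|a w IH] /=; first by rewrite mul1r.
rewrite (le_trans (branch_contract hf hCt a (word_map_I01 hf w Ix) (word_map_I01 hf w Iy)))//.
by rewrite exprS -mulrA ler_wpM2l// rho_ge0.
Qed.

Let D : R := - ln (inf (deriv_values f)).

Lemma cocycle_ge0 w x : I01 x -> 0 <= cocycle f w x.
Proof.
move=> Ix; elim: w => [|a w IH]; first by rewrite cocycle_nil.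
rewrite (cocycle_cons hf)// addr_ge0//.
have := expRN_cocycle_letter_le hf hCt a (word_map_I01 hf w Ix).
move=> /le_lt_trans/(_ rho_lt1); rewrite -expR0 ltr_expR => ?; lra.
Qed.

Lemma cocycle_le w x : I01 x -> cocycle f w x <= D * (size w)%:R.
Proof.
move=> Ix; elim: w => [|a w IH]; first by rewrite cocycle_nil// mulr0.
rewrite (cocycle_cons hf)//= -natr1 mulrDr mulr1 lerD//.
exact/(cocycle_letter_le hf)/word_map_I01.
Qed.

Lemma expRN_cocycle_le w x : I01 x -> expR (- cocycle f w x) <= rho f ^+ size w.
Proof.
move=> Ix; elim: w => [|a w IH]; first by rewrite cocycle_nil// oppr0 expR0.
rewrite (cocycle_cons hf)//= opprD expRD exprS mulrC ler_pM ?expR_ge0//.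
exact/(expRN_cocycle_letter_le hf hCt)/word_map_I01.
Qed.

(* [brn] is the term of the word [w] in the expansion of an iterate of the
   transfer operator applied to [h]; [amp] majorizes it when [H] majorizes [h]. *)
Definition amp (a : R) H w x : R :=
  word_prob w * expR (2 * pi * a * cocycle f w x) * H (word_map f w x).

Definition brn s h w x : R[i] := word_factor s w x * h (word_map f w x).

(* Integrated form of [|h'| <= L * H] for a majorant with [|H'| <= L * H]. Unlike
   the differential form it passes to products and compositions without any
   derivability, with additive constants. *)
Definition explip L h H : Prop := forall x y, I01 x -> I01 y ->
  nc (h x - h y) <= (expR (L * `|x - y|) - 1) * H x.

(** The regularity of [H] is phrased through [explip] with [H] seen as complex-valued, so that the
    estimate for a branch of [h] also gives the one for its majorant, by taking b = 0. *)
Definition cone L h H : Prop :=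
  [/\ forall x, I01 x -> 0 < H x,
      forall x, I01 x -> nc (h x) <= H x,
      explip L h H & explip L (fun x => (H x)%:C%C) H].

Lemma cexp_ofRE a b (t : R) :
  cexp (Complex a b * t%:C%C) = cexp (Complex (a * t) (b * t)).
Proof. by congr cexp; rewrite /=; congr Complex; ring. Qed.

Lemma nc_word_factor a b w x :
  nc (word_factor (Complex a b) w x) = word_prob w * expR (2 * pi * a * cocycle f w x).
Proof.
rewrite ncM nc_real ger0_norm ?ltW ?word_prob_gt0// cexp_ofRE nc_cexp /=.
by congr (_ * expR _); ring.
Qed.

Lemma amp_gt0 a L h H w x : cone L h H -> I01 x -> 0 < amp a H w x.
Proof.
case=> H0 _ _ _ Ix; rewrite /amp !mulr_gt0 ?expR_gt0 ?word_prob_gt0//.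
exact/H0/word_map_I01.
Qed.

Lemma brn_le a b L h H w x : cone L h H -> I01 x ->
  nc (brn (Complex a b) h w x) <= amp a H w x.
Proof.
case=> _ hH _ _ Ix; rewrite ncM nc_word_factor ler_wpM2l//.
  by rewrite mulr_ge0 ?expR_ge0 ?ltW// word_prob_gt0.
exact/hH/word_map_I01.
Qed.

Lemma word_factor_lip a b w x y : I01 x -> I01 y ->
  nc (word_factor (Complex a b) w x - word_factor (Complex a b) w y) <=
  (expR (2 * pi * (`|a| + `|b|) * Ct * `|x - y|) - 1) *
  (word_prob w * expR (2 * pi * a * cocycle f w x)).
Proof.
move=> Ix Iy; set t := 2 * pi * (cocycle f w y - cocycle f w x).
have -> : word_factor (Complex a b) w x - word_factor (Complex a b) w y =
   - (word_factor (Complex a b) w x * (cexp (Complex a b * t%:C%C) - 1)).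
  rewrite mulrBr mulr1 opprB; congr (_ - _).
  by rewrite /word_factor -[_ * cexp _ * cexp _]mulrA -cexpD -mulrDr -realcD /t -mulrDr addrC subrK.
rewrite ncN ncM nc_word_factor mulrC ler_wpM2r//.
  by rewrite mulr_ge0 ?expR_ge0 ?ltW// word_prob_gt0.
rewrite cexp_ofRE (le_trans (cexp_sub1_le _ _))// lerD2r ler_expR.
have -> : `|a * t| + `|b * t| = (`|a| + `|b|) * (2 * pi * `|cocycle f w y - cocycle f w x|).
  by rewrite !normrM -mulrDl (ger0_norm (pi_ge0 R)) (ger0_norm (ler0n R 2)).
rewrite [leRHS](_ : _ = (`|a| + `|b|) * (2 * pi * (Ct * `|x - y|))); last by ring.
rewrite ler_wpM2l ?addr_ge0// ler_wpM2l ?mulr_ge0 ?pi_ge0//.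
by rewrite distrC; apply: cocycle_lip.
Qed.

(** An inequality of Lasota-Yorke type: the factor contributes a term of order |a| + |b|, while the
    contraction of the word shrinks [L]. For long words a constant [L] of order |b| reproduces
    itself. *)
Lemma brn_explip a b L h H w : 0 <= L ->
  (forall x, I01 x -> nc (h x) <= H x) -> explip L h H ->
  explip (2 * pi * (`|a| + `|b|) * Ct + L * rho f ^+ size w)
    (brn (Complex a b) h w) (amp a H w).
Proof.
move=> L0 hH hl x y Ix Iy; rewrite /brn [in expR _]mulrDl /amp.
have C0 := distortion_bound_ge0 hCt.
apply: nc_mul_sub.
- by rewrite !mulr_ge0 ?pi_ge0// addr_ge0.
- by rewrite nc_word_factor.
- exact: word_factor_lip.
- exact/hH/word_map_I01.
- rewrite (le_trans (hl _ _ (word_map_I01 hf w Ix) (word_map_I01 hf w Iy)))//.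
  rewrite ler_wpM2r//; first by rewrite (le_trans (nc_ge0 _) (hH _ (word_map_I01 hf w Ix))).
  rewrite lerD2r ler_expR -mulrA ler_wpM2l//; exact: word_map_contract.
Qed.

Lemma amp_explip a L h H w : 0 <= L -> cone L h H ->
  explip (2 * pi * `|a| * Ct + L * rho f ^+ size w)
    (fun x => (amp a H w x)%:C%C) (amp a H w).
Proof.
move=> L0 [H0 _ _ Hl].
have := @brn_explip a 0 L (fun x => (H x)%:C%C) H w L0 _ Hl.
rewrite normr0 addr0 => K x y Ix Iy.
have aE z : (amp a H w z)%:C%C = brn (Complex a 0) (fun x => (H x)%:C%C) w z.
  rewrite /brn /word_factor cexp_ofRE /amp !realcM mul0r /cexp /= cos0 sin0 mulr1 mulr0.
  by congr (_ * (expR _)%:C%C * _); ring.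
rewrite !aE; apply: K => // z Iz; rewrite nc_real ger0_norm// ltW//; exact: H0.
Qed.

Lemma explip_le L M h H : L <= M -> (forall x, I01 x -> 0 <= H x) ->
  explip L h H -> explip M h H.
Proof.
move=> LM H0 hL x y Ix Iy; rewrite (le_trans (hL x y Ix Iy))// ler_wpM2r ?H0//.
by rewrite lerD2r ler_expR ler_wpM2r.
Qed.

Lemma explip_sum (I : finType) (P : pred I) L (g : I -> R -> R[i]) (G : I -> R -> R) :
  (forall i, explip L (g i) (G i)) ->
  explip L (fun x => \sum_(i | P i) g i x) (fun x => \sum_(i | P i) G i x).
Proof.
move=> gG x y Ix Iy; rewrite -sumrB (le_trans (nc_sum _ _))// mulr_sumr.
by apply: ler_sum => i _; exact: gG.
Qed.

End Words.

(** * The Dolgopyat operator *)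

Section DolgopyatOperator.
Variables (R : realType) (n : nat) (f : 'I_n -> R -> R) (Ct : R).
Hypotheses (hf : is_C2_IFS f) (hCt : distortion_bound f Ct).
Variable p : 'I_n -> R.
Hypothesis hp : positive_prob_vector p.
Implicit Types (L a b : R) (x y : R) (h : R -> R[i]) (H : R -> R).

Local Notation amp := (amp f p).
Local Notation brn := (brn f p).

Variables (N : nat) (t1 t2 : N.-tuple 'I_n).
Hypothesis t12 : t2 != t1.

Definition loss s a h H x : R :=
  amp a H t1 x + amp a H t2 x - nc (brn s h t1 x + brn s h t2 x).

(* The loss of the triangle inequality is charged to the pair of words [t1], [t2]
   at [x], not to the points [f_t x]; hence overlaps between the images of the
   branches do no harm. Only half of it is subtracted, so that [dolg] stays
   comparable to the full sum and the cone is preserved. *)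
Definition dolg s a h H x : R :=
  \sum_(w : N.-tuple 'I_n) amp a H w x - loss s a h H x / 2.

Lemma sum_ampE a H x : \sum_(w : N.-tuple 'I_n) amp a H w x =
  amp a H t1 x + amp a H t2 x +
  \sum_(w : N.-tuple 'I_n | (w != t1) && (w != t2)) amp a H w x.
Proof. by rewrite (bigD1 t1)//= (bigD1 t2)//= addrA. Qed.

Lemma dolg_ge a b L h H x : cone L h H -> I01 x ->
  \sum_(w : N.-tuple 'I_n) amp a H w x <= 2 * dolg (Complex a b) a h H x.
Proof.
move=> hH Ix; rewrite /dolg /loss sum_ampE.
have r0 : 0 <= \sum_(w : N.-tuple 'I_n | (w != t1) && (w != t2)) amp a H w x.
  by apply: sumr_ge0 => w _; exact: ltW (amp_gt0 hf hp _ _ hH Ix).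
have := nc_ge0 (brn (Complex a b) h t1 x + brn (Complex a b) h t2 x); lra.
Qed.

Lemma loss_ge0 a b L h H x : cone L h H -> I01 x -> 0 <= loss (Complex a b) a h H x.
Proof.
move=> hH Ix; rewrite subr_ge0 (le_trans (ncD _ _))// lerD//;
exact: (brn_le hf hp a b _ hH Ix).
Qed.

(** The branches are required to be twice as regular as the cone. This pays for measuring variations
    against [dolg], which may be as small as half of the full sum. *)
Lemma dolg_cone a b L h H : 0 <= L ->
  2 * (2 * pi * (`|a| + `|b|) * Ct + L * rho f ^+ N) <= L ->
  cone L h H ->
  cone L (iter N (transfer f p (Complex a b)) h) (dolg (Complex a b) a h H).
Proof.
set L' := _ + _; set s := Complex a b => L0 LL hH.
have C0 := distortion_bound_ge0 hCt; have rh0 := rho_ge0 hf hCt hp.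
have L'0 : 0 <= L'.
  by rewrite addr_ge0// ?mulr_ge0 ?exprn_ge0 ?pi_ge0 ?addr_ge0.
pose S x := \sum_(w : N.-tuple 'I_n) amp a H w x.
have S2 x : I01 x -> S x <= 2 * dolg s a h H x by move=> Ix; exact: dolg_ge hH Ix.
have aL (w : N.-tuple 'I_n) : explip L' (fun x => (amp a H w x)%:C%C) (amp a H w).
  apply: explip_le (amp_explip hf hCt hp a w L0 hH).
    rewrite size_tuple lerD2r ler_wpM2r// ler_wpM2l ?mulr_ge0 ?pi_ge0// lerDl//.
  by move=> x Ix; exact: ltW (amp_gt0 hf hp _ _ hH Ix).
have bL (w : N.-tuple 'I_n) : explip L' (brn s h w) (amp a H w).
  case: hH => _ hH1 hH2 _.
  by have := brn_explip hf hCt hp a b w L0 hH1 hH2; rewrite size_tuple.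
(* Doubling the exponent absorbs the factor 2, because 2(E - 1) <= E^2 - 1. *)
have eL x y (t : R) : I01 x -> t <= (expR (L' * `|x - y|) - 1) * S x ->
    t <= (expR (L * `|x - y|) - 1) * dolg s a h H x.
  move=> Ix ht; apply: (le_trans ht); have e1 := expR_ge1Dx (L' * `|x - y|).
  have u0 : 0 <= L' * `|x - y| by rewrite mulr_ge0.
  have e2 : expR (L' * `|x - y|) ^+ 2 <= expR (L * `|x - y|).
    by rewrite expr2 -expRD ler_expR -mulrDl ler_wpM2r//; lra.
  have D0 : 0 <= S x by apply: sumr_ge0 => w _; exact: ltW (amp_gt0 hf hp _ _ hH Ix).
  have := S2 x Ix; set E := expR (L' * _) in e1 e2 *; set F := expR _ in e2 *.
  set d := dolg _ _ _ _ _ => Sd.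
  apply: (@le_trans _ _ ((E - 1) * (2 * d))); first by rewrite ler_wpM2l//; lra.
  rewrite mulrA ler_wpM2r//; first by lra.
  by have := sqr_ge0 (E - 1); rewrite sqrrB1; lra.
split.
- move=> x Ix; suff : 0 < S x by have := S2 x Ix; lra.
  rewrite /S sum_ampE -addrA ltr_wpDr ?(amp_gt0 hf hp _ _ hH)// addr_ge0 ?sumr_ge0//.
    exact: ltW (amp_gt0 hf hp _ _ hH Ix).
  by move=> w _; exact: ltW (amp_gt0 hf hp _ _ hH Ix).
(* The distinguished pair contributes half of its amplitudes plus half of |z1 + z2| to [dolg], and
   this dominates |z1 + z2|. *)
- move=> x Ix; rewrite iter_transfer// /dolg /loss sum_ampE.
  rewrite (bigD1 t1)//= (bigD1 t2)//= -!/(brn s h _ x) addrA.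
  have z1 := brn_le hf hp a b t1 hH Ix; have z2 := brn_le hf hp a b t2 hH Ix.
  rewrite (le_trans (ncD _ _))//.
  set zz := \sum_(_ | _) _; have : nc zz <= \sum_(w : N.-tuple 'I_n | (w != t1) && (w != t2)) amp a H w x.
    rewrite (le_trans (nc_sum _ _))//; apply: ler_sum => w _.
    exact: (brn_le hf hp a b _ hH Ix).
  have := ncD (brn s h t1 x) (brn s h t2 x); lra.
- move=> x y Ix Iy; rewrite !iter_transfer//; apply: eL => //.
  exact: (explip_sum predT (fun w : N.-tuple 'I_n => bL w)).
- move=> x y Ix Iy; apply: eL => //.
  rewrite -raddfB nc_real /dolg /loss !sum_ampE /S sum_ampE.
  set r1 := \sum_(w | _) _; set r2 := \sum_(w | _) _.
  have rr : `|r1 - r2| <= (expR (L' * `|x - y|) - 1) * r1.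
    have := explip_sum (fun w : N.-tuple 'I_n => (w != t1) && (w != t2)) aL Ix Iy.
    by rewrite -!rmorph_sum -raddfB nc_real.
  have a1 := aL t1 x y Ix Iy; have a2 := aL t2 x y Ix Iy.
  rewrite -raddfB nc_real in a1; rewrite -raddfB nc_real in a2.
  exact: lip_half_cancel (bL t1 x y Ix Iy) (bL t2 x y Ix Iy) a1 a2 rr.
Qed.

(** Dividing by the amplitude removes the probability and the real exponential. What remains is a
    pure phase times h/H, so the comparison of phases does not see [a]. *)
Lemma brn_normalized a b L h H w x : cone L h H -> I01 x ->
  ((amp a H w x)^-1)%:C%C * brn (Complex a b) h w x =
  cexp (Complex 0 (2 * pi * b * cocycle f w x)) *
  (((H (word_map f w x))^-1)%:C%C * h (word_map f w x)).
Proof.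
case=> H0 _ _ _ Ix; have HI := H0 _ (word_map_I01 hf w Ix).
have q0 : 0 < word_prob p w * expR (2 * pi * a * cocycle f w x).
  by rewrite mulr_gt0 ?expR_gt0 ?(word_prob_gt0 hp).
rewrite /brn /word_factor.
have -> : cexp (Complex a b * (2 * pi * cocycle f w x)%:C%C) =
    (expR (2 * pi * a * cocycle f w x))%:C%C *
    cexp (Complex 0 (2 * pi * b * cocycle f w x)).
  have aE k : k * (2 * pi * cocycle f w x) = 2 * pi * k * cocycle f w x by ring.
  rewrite cexp_ofRE !aE /cexp /= expR0.
  by congr Complex; rewrite /=; ring.
rewrite /amp invfM realcM.
have := realcM (word_prob p w * expR (2 * pi * a * cocycle f w x))^-1
  (word_prob p w * expR (2 * pi * a * cocycle f w x)).
rewrite mulVf ?gt_eqF// [X in _ = _ * X -> _]realcM => e.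
set u := ((word_prob p w * expR _)^-1)%:C%C in e *.
transitivity ((u * ((word_prob p w)%:C%C * (expR (2 * pi * a * cocycle f w x))%:C%C)) *
   (cexp (Complex 0 (2 * pi * b * cocycle f w x)) *
   (((H (word_map f w x))^-1)%:C%C * h (word_map f w x)))); first by ring.
by rewrite -e mul1r.
Qed.

(* If both losses were small, the normalized branches would be nearly equal at [x]
   and at [y]; but between [x] and [y] the phase difference turns by about
   [b * |x - y|], while the other factors move by only [rho ^ N] times that. *)
Lemma loss_large a b L h H m q x y : 0 <= L -> cone L h H -> I01 x -> I01 y ->
  m * `|x - y| <= `|(cocycle f t1 x - cocycle f t2 x) - (cocycle f t1 y - cocycle f t2 y)| ->
  0 < q <= 1 / 2 ->
  4 * pi * Ct * (`|b| * `|x - y|) <= 1 ->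
  L * rho f ^+ N * `|x - y| <= 1 / 2 ->
  16 * (L * rho f ^+ N) <= m * `|b| ->
  8 * q < m * `|b| * `|x - y| ->
  exists2 z, z = x \/ z = y & exists2 t : N.-tuple 'I_n, t = t1 \/ t = t2 &
    q ^+ 2 * amp a H t z <= loss (Complex a b) a h H z.
Proof.
move=> L0 hH Ix Iy mxy /andP[q0 q1] cb Lr Lm mb.
have rh0 := rho_ge0 hf hCt hp.
have q2 : 1 / 2 <= 1 - q ^+ 2 by nra.
apply: contrapT => no.
have {}no z (t : N.-tuple 'I_n) : z = x \/ z = y -> t = t1 \/ t = t2 ->
    loss (Complex a b) a h H z < q ^+ 2 * amp a H t z.
  by move=> zE tE; rewrite ltNge; apply/negP => le; apply: no; exists z => //; exists t.
have al z : I01 z -> z = x \/ z = y ->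
   nc (((amp a H t1 z)^-1)%:C%C * brn (Complex a b) h t1 z
       - ((amp a H t2 z)^-1)%:C%C * brn (Complex a b) h t2 z) <= 2 * q /\
   1 - q ^+ 2 <= nc (((amp a H t1 z)^-1)%:C%C * brn (Complex a b) h t1 z).
  move=> Iz zE; apply: almost_aligned.
  - exact: (amp_gt0 hf hp _ _ hH).
  - exact: (amp_gt0 hf hp _ _ hH).
  - by rewrite ltW//=; lra.
  - exact: (brn_le hf hp _ _ _ hH).
  - exact: (brn_le hf hp _ _ _ hH).
  - by apply: no => //; left.
  - by apply: no => //; right.
have [ax g1] := al x Ix (or_introl erefl).
have [ay _] := al y Iy (or_intror erefl).
rewrite !(brn_normalized _ _ _ hH)// in ax ay g1.
set ph := fun (t : N.-tuple 'I_n) z => cexp (Complex 0 (2 * pi * b * cocycle f t z)) in ax ay g1.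
have nph t z : nc (cexp (Complex 0 (2 * pi * b * cocycle f t z))) = 1 by rewrite nc_cexp expR0.
rewrite ncM nph mul1r in g1.
set u := L * rho f ^+ N * `|x - y| in Lr.
have u0 : 0 <= u by rewrite !mulr_ge0 ?exprn_ge0.
(* As [u <= 1 / 2], [expR u - 1] is at most [2 * u], and the quotient h/H moves by at most twice
   that. *)
have lip (t : N.-tuple 'I_n) :
   nc (((H (word_map f t x))^-1)%:C%C * h (word_map f t x)
      - ((H (word_map f t y))^-1)%:C%C * h (word_map f t y)) <= 4 * u.
  case: (hH) => H0 hh h1 h2.
  have Ix' := word_map_I01 hf t Ix; have Iy' := word_map_I01 hf t Iy.
  have E1 : expR (L * `|word_map f t x - word_map f t y|) - 1 <= 2 * u.
    have e2 := @expR_le1D2x R u; rewrite u0 Lr in e2; have {}e2 := e2 isT.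
    suff e1 : expR (L * `|word_map f t x - word_map f t y|) <= expR u.
      by rewrite lerBlDl (le_trans e1).
    rewrite ler_expR /u -mulrA ler_wpM2l//.
    by have := word_map_contract hf hCt hp t Ix Iy; rewrite size_tuple.
  rewrite (_ : 4 * u = 2 * (2 * u)); last by ring.
  apply: nc_ratio_sub; rewrite ?H0 ?hh//.
    apply: le_trans (h1 _ _ Ix' Iy') _; rewrite ler_wpM2r// ltW//; exact: H0.
  rewrite -nc_real raddfB; apply: le_trans (h2 _ _ Ix' Iy') _.
  by rewrite ler_wpM2r// ltW//; exact: H0.
have g12 : 1 / 2 <= nc (((H (word_map f t1 x))^-1)%:C%C * h (word_map f t1 x)).
  exact: le_trans q2 g1.
have := phase_rigidity (nph _ _) (nph _ _) (nph _ _) (nph _ _) ax ay (lip t1) (lip t2) g12.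
apply/negP; rewrite -ltNge; apply: (@phase_gap _ b m Ct `|x - y|) => //.
- exact: distortion_bound_ge0 hCt.
- exact: cocycle_lip.
- exact: cocycle_lip.
- by rewrite /u mulrA ler_wpM2r.
- exact: ltW.
Qed.
End DolgopyatOperator.

(** * From a gain at scale 1/b to a gain for the random walk *)

Section ScaleInduction.
Variables (R : realType) (n : nat) (f : 'I_n -> R -> R) (Ct : R).
Hypotheses (hf : is_C2_IFS f) (hCt : distortion_bound f Ct).
Variable p : 'I_n -> R.
Hypothesis hp : positive_prob_vector p.
Implicit Types (x y : R) (v w : seq 'I_n).

Let D : R := - ln (inf (deriv_values f)).

Variables (u1 u2 : 'I_n) (d0 pm D1 kap : R).
Hypotheses (d0P : forall y, I01 y -> d0 <= `|f u1 y - f u2 y|)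
  (d0_ge0 : 0 <= d0) (pm1 : pm <= p u1) (pm2 : pm <= p u2) (D1_gt0 : 0 < D1) (kap_ge0 : 0 <= kap).

(** The image of [v] has size comparable to [D1 / beta]. All points [X a] lie within [D1 / beta] of
    each other, while distortion and the gap [d0] keep [X u1] and [X u2] apart by a fixed fraction
    of that scale, so one of them gains. Since [F] varies there by at most the factor [expR 1], the
    gaining point carries at least the share [pm * expR (-1)] of the average. *)
Lemma walk_gain (F G : R -> R) (E2 beta : R) (v : seq 'I_n) y : 0 < beta -> 0 <= E2 ->
  (forall x, I01 x -> 0 <= F x) ->
  (forall x, I01 x -> G x <= E2 * F x) ->
  (forall x1 x2, I01 x1 -> I01 x2 ->
     expR (- (3 * Ct + D)) * D1 * d0 <= beta * `|x1 - x2| <= D1 ->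
     exists2 z, z = x1 \/ z = x2 & G z <= E2 * (1 - kap) * F z) ->
  (forall x1 x2, I01 x1 -> I01 x2 -> beta * `|x1 - x2| <= D1 -> F x2 <= expR 1 * F x1) ->
  I01 y ->
  expR (- (2 * Ct + D)) * D1 <= beta * expR (- cocycle f v 0) <= expR (- Ct) * D1 ->
  walk f p (G \o word_map f v) y <=
    E2 * (1 - kap * pm * expR (- 1)) * walk f p (F \o word_map f v) y.
Proof.
move=> b0 E0 F0 GE G2 FE Iy /andP[s1 s2].
pose X a := word_map f v (f a y).
have IX a : I01 (X a) by apply: (word_map_I01 hf); exact: (branch_I01 hf).
have I1 a c : `|f a y - f c y| <= 1.
  have := branch_I01 hf a Iy; have := branch_I01 hf c Iy.
  rewrite /I01 /= !in_itv /= => /andP[? ?] /andP[? ?].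
  by rewrite ler_norml; apply/andP; split; lra.
have XX a c : beta * `|X a - X c| <= D1.
  have [_ h] := andP (word_map_distortion hf hCt v (branch_I01 hf a Iy) (branch_I01 hf c Iy)).
  have {}h : `|X a - X c| <= expR Ct * expR (- cocycle f v 0).
    by rewrite (le_trans h)// ler_piMr// mulr_ge0 ?expR_ge0.
  apply: (@le_trans _ _ (expR Ct * (beta * expR (- cocycle f v 0)))).
    by rewrite mulrCA ler_wpM2l// ltW.
  apply: (@le_trans _ _ (expR Ct * (expR (- Ct) * D1))); first by rewrite ler_wpM2l ?expR_ge0.
  by rewrite mulrA -expRD subrr expR0 mul1r.
have XL : expR (- (3 * Ct + D)) * D1 * d0 <= beta * `|X u1 - X u2|.
  have [h _] := andP (word_map_distortion hf hCt v (branch_I01 hf u1 Iy) (branch_I01 hf u2 Iy)).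
  apply: le_trans (ler_wpM2l (ltW b0) h).
  apply: (@le_trans _ _ (expR (- Ct) * (beta * expR (- cocycle f v 0)) * d0)); last first.
    rewrite [leRHS](_ : _ = expR (- Ct) * (beta * expR (- cocycle f v 0)) * `|f u1 y - f u2 y|);
      last by ring.
    by rewrite ler_wpM2l ?d0P// mulr_ge0 ?expR_ge0// mulr_ge0 ?expR_ge0// ltW.
  rewrite ler_wpM2r// (_ : - (3 * Ct + D) = - Ct + - (2 * Ct + D)); last by ring.
  by rewrite expRD -mulrA ler_wpM2l ?expR_ge0.
have [u [pu gu]] : exists u, pm <= p u /\ G (X u) <= E2 * (1 - kap) * F (X u).
  have [|z [->|->] h] := G2 _ _ (IX u1) (IX u2); first by rewrite XL XX.
    by exists u1.
  by exists u2.
have p0 a : 0 < p a by case: hp.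
have S1 : \sum_(a < n) p a = 1 by case: hp.
have SF : walk f p (F \o word_map f v) y <= expR 1 * F (X u).
  apply: (@le_trans _ _ (\sum_(a < n) p a * (expR 1 * F (X u)))).
    apply: ler_sum => a _; rewrite ler_wpM2l ?(ltW (p0 a))//=; exact: (FE _ _ (IX u) (IX a) (XX u a)).
  by rewrite -mulr_suml S1 mul1r.
have SG : walk f p (G \o word_map f v) y <=
    E2 * (walk f p (F \o word_map f v) y - kap * p u * F (X u)).
  rewrite /walk (bigD1 u)//= [in leRHS](bigD1 u)//= -!/(X _).
  have -> : E2 * (p u * F (X u) + \sum_(i < n | i != u) p i * F (word_map f v (f i y))
      - kap * p u * F (X u)) = p u * (E2 * (1 - kap) * F (X u)) +
      \sum_(i < n | i != u) p i * (E2 * F (word_map f v (f i y))).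
    under [in RHS]eq_bigr do rewrite mulrCA.
    by rewrite -mulr_sumr; ring.
  apply: lerD; first by rewrite ler_wpM2l ?(ltW (p0 u)).
  by apply: ler_sum => a _; rewrite ler_wpM2l ?(ltW (p0 a))//; exact: (GE _ (IX a)).
apply: (le_trans SG).
set m := walk f p (F \o word_map f v) y in SF *.
rewrite -[E2 * _ * m]mulrA ler_wpM2l// mulrBl mul1r lerD2l lerN2.
have {}SF : expR (-1) * m <= F (X u).
  by rewrite expRN mulrC ler_pdivrMr ?expR_gt0// mulrC.
have m0 : 0 <= m.
  by apply: sumr_ge0 => a _; rewrite mulr_ge0 ?(ltW (p0 a))//=; exact: (F0 _ (IX a)).
have : pm * (expR (-1) * m) <= p u * F (X u).
  apply: le_trans (ler_wpM2l (ltW (p0 u)) SF).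
  by rewrite ler_wpM2r// mulr_ge0 ?expR_ge0.
move=> /(ler_wpM2l kap_ge0); rewrite !mulrA; by [].
Qed.

(* Downward induction along the words [v]: as long as [f_v] has image larger than
   the critical scale, the walk is split according to its next letter. *)
Lemma iter_walk_gain (F G : R -> R) (E2 beta : R) (k0 : nat) :
  0 < beta -> 0 <= E2 -> D1 <= beta ->
  (forall x, I01 x -> 0 <= F x) ->
  (forall x, I01 x -> G x <= E2 * F x) ->
  (forall x1 x2, I01 x1 -> I01 x2 ->
     expR (- (3 * Ct + D)) * D1 * d0 <= beta * `|x1 - x2| <= D1 ->
     exists2 z, z = x1 \/ z = x2 & G z <= E2 * (1 - kap) * F z) ->
  (forall x1 x2, I01 x1 -> I01 x2 -> beta * `|x1 - x2| <= D1 -> F x2 <= expR 1 * F x1) ->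
  beta * rho f ^+ k0 <= expR (- Ct) * D1 ->
  forall M x, (k0 < M)%N -> I01 x ->
  iter M (walk f p) G x <= E2 * (1 - kap * pm * expR (- 1)) * iter M (walk f p) F x.
Proof.
move=> b0 E0 Db F0 GE G2 FE rk M x kM Ix.
have I0 : I01 (0 : R) by rewrite /I01 /= in_itv /= lexx ler01.
have C0 := distortion_bound_ge0 hCt.
have D0 : 0 <= D.
  by have := cocycle_le hf [:: u1] I0; have := cocycle_ge0 hf hCt [:: u1] I0; rewrite /D mulr1; lra.
(* [j] bounds the number of letters still to be appended to [v]: at [j = 0] the word has at least
   [k0] letters, and its image has come down to the critical scale. *)
suff K j : forall v M x, (k0 <= size v + j)%N -> (j < M)%N -> I01 x ->
    expR (- (2 * Ct + D)) * D1 <= beta * expR (- cocycle f v 0) ->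
    iter M (walk f p) (G \o word_map f v) x <=
    E2 * (1 - kap * pm * expR (- 1)) * iter M (walk f p) (F \o word_map f v) x.
  apply: (K k0 [::] M x) => //.
  rewrite cocycle_nil// oppr0 expR0 mulr1 (le_trans _ Db)// ler_piMl ?(ltW D1_gt0)//.
  by rewrite -[leRHS]expR0 ler_expR; lra.
have base v M' z : (0 < M')%N -> I01 z ->
    expR (- (2 * Ct + D)) * D1 <= beta * expR (- cocycle f v 0) <= expR (- Ct) * D1 ->
    iter M' (walk f p) (G \o word_map f v) z <=
    E2 * (1 - kap * pm * expR (- 1)) * iter M' (walk f p) (F \o word_map f v) z.
  case: M' => // M' _ Iz hv; rewrite !iterSr -(walkZ f p).
  by apply: (walk_le hf hp) => // y Iy; exact: (walk_gain (beta := beta)).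
elim: j => [|j IH] v M' z kv jM Iz s1.
  apply: base => //; rewrite s1 /= (le_trans _ rk)// ler_wpM2l ?(ltW b0)//.
  apply: le_trans (expRN_cocycle_le hf hCt v I0) _.
  by rewrite ler_wiXn2l ?(rho_ge0 hf hCt hp) ?ltW ?(rho_lt1 hf)//; move: kv; rewrite addn0.
have [s2|s2] := leP (beta * expR (- cocycle f v 0)) (expR (- Ct) * D1).
  by apply: base; rewrite ?s1//; apply: leq_trans jM.
case: M' jM => // M' jM; rewrite !(iter_walkSr f p) mulr_sumr.
apply: ler_sum => a _; rewrite mulrCA ler_wpM2l//; first by case: hp => /(_ a)/ltW.
have vaE (H : R -> R) : (H \o word_map f v) \o f a = H \o word_map f (rcons v a).
  by apply/funext => y /=; rewrite -cats1 word_map_cat.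
rewrite !vaE; apply: IH; [by rewrite size_rcons addSnnS|exact: jM|exact: Iz|].
rewrite -cats1 (cocycle_cat hf)//.
(* Before the letter [a] the scale exceeded [expR (- Ct) * D1]. One letter multiplies it by at least
   [expR (- D)], and moving the base point between 0 and [f a 0] costs one more [expR (- Ct)]; this
   is the origin of 2Ct + D. *)
apply: (@le_trans _ _ (expR (- (Ct + D)) * (beta * expR (- cocycle f v 0)))).
  rewrite (_ : - (2 * Ct + D) = - (Ct + D) + - Ct); last by ring.
  by rewrite expRD -mulrA ler_wpM2l ?expR_ge0// ltW.
rewrite mulrCA ler_wpM2l ?(ltW b0)// -expRD ler_expR.
have := cocycle_le hf [:: a] I0; rewrite mulr1 -/D.
have Ia := branch_I01 hf a I0.
have := cocycle_lip hf hCt v Ia I0; rewrite subr0.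
move: (Ia); rewrite {1}/I01 /= in_itv /= => /andP[a0 a1].
rewrite (ger0_norm a0) ler_norml => /andP[_ h].
have : Ct * f a 0 <= Ct by rewrite ler_piMr.
move: h; rewrite /=.
move: (cocycle f [:: a] 0) (cocycle f v (f a 0)) (cocycle f v 0) => c1 c2 c3; lra.
Qed.
End ScaleInduction.

(** * Mean-square estimates for the Dolgopyat operator *)

Section L2Contraction.
Variables (R : realType) (n : nat) (f : 'I_n -> R -> R) (Ct : R).
Hypotheses (hf : is_C2_IFS f) (hCt : distortion_bound f Ct).
Variable p : 'I_n -> R.
Hypothesis hp : positive_prob_vector p.
Variables (N : nat) (t1 t2 : N.-tuple 'I_n).
Hypothesis t12 : t2 != t1.

Lemma weighted_Cauchy_Schwarz (I : finType) (P T X : I -> R) :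
  (forall i, 0 <= P i) -> 0 < \sum_i P i * T i ^+ 2 ->
  (\sum_i P i * (T i * X i)) ^+ 2 <= (\sum_i P i * T i ^+ 2) * \sum_i P i * X i ^+ 2.
Proof.
move=> P0; set B := \sum_i _ => B0; set Y := \sum_i _; set Z := \sum_i _.
have : 0 <= \sum_i P i * (B * X i - Y * T i) ^+ 2.
  by apply: sumr_ge0 => i _; rewrite mulr_ge0 ?sqr_ge0.
have -> : \sum_i P i * (B * X i - Y * T i) ^+ 2 = B ^+ 2 * Z - 2 * B * Y * Y + Y ^+ 2 * B.
  rewrite /Z [in RHS]mulr_sumr [X in _ - X]mulr_sumr [X in _ + X]mulr_sumr.
  by rewrite -sumrB -big_split /=; apply: eq_bigr => i _; ring.
rewrite (_ : _ + _ = B * (B * Z - Y ^+ 2)); last by ring.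
by rewrite pmulr_rge0// subr_ge0.
Qed.

Lemma dolg_sqr_le (a b L E : R) h H x : cone L h H -> I01 x ->
  (forall w : N.-tuple 'I_n, expR (2 * pi * a * cocycle f w x) <= E) ->
  dolg f p t1 t2 (Complex a b) a h H x ^+ 2 <=
    E ^+ 2 * iter N (walk f p) (fun y => H y ^+ 2) x.
Proof.
move=> hH Ix aE; have l0 := loss_ge0 hf hp t1 t2 a b hH Ix.
have S0 w : 0 < amp f p a H w x := amp_gt0 hf hp a w hH Ix.
have E0 : 0 <= E := le_trans (expR_ge0 _) (aE t1).
have H0 (w : N.-tuple 'I_n) : 0 <= H (word_map f w x).
  by case: (hH) => /(_ _ (word_map_I01 hf w Ix))/ltW.
have SE : \sum_(w : N.-tuple 'I_n) amp f p a H w x <= E * iter N (walk f p) H x.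
  rewrite iter_walk mulr_sumr; apply: ler_sum => w _.
  rewrite /amp mulrAC [leRHS]mulrC ler_wpM2l ?aE// mulr_ge0//.
  by rewrite ltW// (word_prob_gt0 hp).
apply: (@le_trans _ _ ((E * iter N (walk f p) H x) ^+ 2)); last first.
  by rewrite exprMn ler_wpM2l ?sqr_ge0// (iter_walk_sqr f hp).
have := dolg_ge hf hp t12 a b hH Ix.
have : 0 <= \sum_(w : N.-tuple 'I_n) amp f p a H w x.
  by apply: sumr_ge0 => w _; exact: ltW.
move=> s0 s2; rewrite lerXn2r ?nnegrE//; [lra|lra|].
by apply: le_trans SE; rewrite /dolg; lra.
Qed.

(** The loss allows the amplitude of [t] to be multiplied by [1 - q / 2]. Cauchy-Schwarz moves the
    square of this factor onto the weights, whose total drops from 1 to at most [1 - P * q / 2]. *)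
Lemma dolg_sqr_gain (a b L E q P : R) h H x (t : N.-tuple 'I_n) : cone L h H -> I01 x ->
  (forall w : N.-tuple 'I_n, expR (2 * pi * a * cocycle f w x) <= E) ->
  0 < q <= 1 -> P <= word_prob p t ->
  q * amp f p a H t x <= loss f p t1 t2 (Complex a b) a h H x ->
  dolg f p t1 t2 (Complex a b) a h H x ^+ 2 <=
    E ^+ 2 * (1 - P * q / 2) * iter N (walk f p) (fun y => H y ^+ 2) x.
Proof.
move=> hH Ix aE /andP[q0 q1] Pt lt; have l0 := loss_ge0 hf hp t1 t2 a b hH Ix.
have S0 w : 0 < amp f p a H w x := amp_gt0 hf hp a w hH Ix.
have E0 : 0 <= E := le_trans (expR_ge0 _) (aE t1).
have H0 (w : N.-tuple 'I_n) : 0 <= H (word_map f w x).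
  by case: (hH) => /(_ _ (word_map_I01 hf w Ix))/ltW.
have P0 (w : N.-tuple 'I_n) : 0 < word_prob p w := word_prob_gt0 hp w.
pose T (w : N.-tuple 'I_n) : R := if w == t then 1 - q / 2 else 1.
have T0 w : 0 < T w by rewrite /T; case: ifP => _; lra.
have dT : dolg f p t1 t2 (Complex a b) a h H x <= \sum_w T w * amp f p a H w x.
  rewrite /dolg (bigD1 t)//= [in leRHS](bigD1 t)//= {1}/T eqxx.
  rewrite [in leRHS](eq_bigr (fun w : N.-tuple 'I_n => amp f p a H w x)); last first.
    by move=> w /negbTE wt; rewrite /T wt mul1r.
  move: lt (S0 t); move: (loss _ _ _ _ _ _ _ _ _) (amp f p a H t x) => l A; lra.
have dE : dolg f p t1 t2 (Complex a b) a h H x <=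
    E * \sum_(w : N.-tuple 'I_n) word_prob p w * (T w * H (word_map f w x)).
  apply: (le_trans dT); rewrite mulr_sumr; apply: ler_sum => w _; rewrite /amp.
  rewrite [leLHS](_ : _ = expR (2 * pi * a * cocycle f w x) *
     (word_prob p w * (T w * H (word_map f w x)))).
    by rewrite ler_wpM2r ?aE// mulr_ge0 ?mulr_ge0// ltW.
  by move: (expR _) (word_prob _ _) (T w) (H _) => *; ring.
have d0 : 0 <= dolg f p t1 t2 (Complex a b) a h H x.
  have := dolg_ge hf hp t12 a b hH Ix.
  have : 0 <= \sum_(w : N.-tuple 'I_n) amp f p a H w x.
    by apply: sumr_ge0 => w _; exact: ltW.
  lra.
have B0 : 0 < \sum_(w : N.-tuple 'I_n) word_prob p w * T w ^+ 2.
  rewrite (bigD1 t)//= ltr_wpDr ?mulr_gt0 ?exprn_gt0// sumr_ge0// => w _.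
  by rewrite mulr_ge0 ?sqr_ge0// ltW.
have BP : \sum_(w : N.-tuple 'I_n) word_prob p w * T w ^+ 2 <= 1 - P * q / 2.
  have := sum_word_prob f hp N; rewrite (bigD1 t)//= [X in _ -> X <= _](bigD1 t)//= {1}/T eqxx.
  rewrite [X in _ -> _ + X <= _](eq_bigr (fun w : N.-tuple 'I_n => word_prob p w)); last first.
    by move=> w /negbTE wt; rewrite /T wt expr1n mulr1.
  move: Pt (P0 t); move: (word_prob p t) (\sum_(_ | _) _) => A B PA A0 AB.
  have : A * (1 - q / 2) ^+ 2 <= A * (1 - q / 2).
    by rewrite ler_wpM2l ?(ltW A0)// expr2 ler_piMl//; lra.
  have : P * q <= A * q by rewrite ler_wpM2r// ltW.
  lra.
apply: (@le_trans _ _ ((E * \sum_(w : N.-tuple 'I_n) word_prob p w * (T w * H (word_map f w x))) ^+ 2)).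
  by rewrite lerXn2r ?nnegrE// (le_trans d0).
rewrite exprMn -mulrA ler_wpM2l ?sqr_ge0//.
apply: le_trans (weighted_Cauchy_Schwarz _ (fun w => ltW (P0 w)) B0) _.
rewrite iter_walk ler_wpM2r// sumr_ge0// => w _.
by rewrite mulr_ge0 ?sqr_ge0// ltW.
Qed.

(** After contraction by words of length [N], [H] varies by at most [expR (1 / 2)]; squaring gives
    the factor [expR 1] demanded for the gain along the walk. *)
Lemma iter_walk_sqr_lip (L d : R) h H x y : 0 <= L -> cone L h H -> I01 x -> I01 y ->
  `|x - y| <= d -> L * rho f ^+ N * d <= 1 / 2 ->
  iter N (walk f p) (fun z => H z ^+ 2) y <= expR 1 * iter N (walk f p) (fun z => H z ^+ 2) x.
Proof.
move=> L0 [H0 _ _ Hl] Ix Iy xy Ld.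
rewrite !iter_walk mulr_sumr; apply: ler_sum => w _.
rewrite [leRHS]mulrCA ler_wpM2l ?(ltW (word_prob_gt0 hp _))//.
have Ix' := word_map_I01 hf w Ix; have Iy' := word_map_I01 hf w Iy.
have Hy := H0 _ Iy'; have Hx := H0 _ Ix'.
have {}Hl : H (word_map f w y) <= expR (1 / 2) * H (word_map f w x).
  have := Hl _ _ Ix' Iy'; rewrite -raddfB nc_real ler_norml => /andP[h1 _].
  have h2 : expR (L * `|word_map f w x - word_map f w y|) <= expR (1 / 2).
    rewrite ler_expR (le_trans _ Ld)// -mulrA ler_wpM2l//.
    have := word_map_contract hf hCt hp w Ix Iy; rewrite size_tuple => /le_trans; apply.
    by rewrite ler_wpM2l// exprn_ge0// (rho_ge0 hf hCt hp).
  have {h2} := ler_wpM2r (ltW Hx) h2; move: h1; rewrite mulrBl mul1r; lra.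
have -> : expR 1 = expR (1 / 2) ^+ 2 :> R by rewrite expr2 -expRD; congr expR; field.
by rewrite -exprMn lerXn2r ?nnegrE ?(ltW Hy)// mulr_ge0 ?expR_ge0 ?(ltW Hx).
Qed.
End L2Contraction.

(** * Iteration and choice of constants *)

(** The time splits into [k] blocks of length [N] and a remainder [M], which exceeds the waiting
    time [k0] as soon as there is a block, yet is never much longer. *)
Lemma split_steps (j k0 N : nat) : (0 < N)%N ->
  exists k M : nat, [/\ j = (M + k * N)%N, (M <= (k0 + N).+1)%N &
    (k == 0)%N || (k0 < M)%N].
Proof.
move=> N0; have [jk|kj] := leqP j k0.
  by exists 0%N, j; split; [rewrite mul0n addn0|rewrite (leq_trans jk)// leqW// leq_addr|].
have := divn_eq (j - k0.+1) N; have := ltn_pmod (j - k0.+1) N0.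
move: ((j - k0.+1) %/ N)%N ((j - k0.+1) %% N)%N => k r rN e.
by exists k, (k0.+1 + r)%N; split; lia.
Qed.

Section Iteration.
Variables (R : realType) (n : nat) (f : 'I_n -> R -> R) (Ct : R).
Hypotheses (hf : is_C2_IFS f) (hCt : distortion_bound f Ct).
Variable p : 'I_n -> R.
Hypothesis hp : positive_prob_vector p.

Let D : R := - ln (inf (deriv_values f)).
(** The cone constant will be A|b|. The factor 16 keeps 2 pi (|a| + |b|) Ct below a quarter of it
    when |a| <= |b|; together with [rho f ^+ N <= 1 / 4] this meets the requirement of [dolg_cone].
    Adding 1 keeps [A >= 1] even if [Ct = 0]. *)
Let A : R := 16 * pi * (Ct + 1).

Variables (N : nat) (t1 t2 : N.-tuple 'I_n) (m d0 pm P q : R) (u1 u2 : 'I_n).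
Hypotheses (t12 : t2 != t1) (m0 : 0 < m)
  (phase : forall x y, I01 x -> I01 y -> m * `|x - y| <=
     `|(cocycle f t1 x - cocycle f t2 x) - (cocycle f t1 y - cocycle f t2 y)|)
  (rN : rho f ^+ N <= 1 / 4) (rm : 16 * (A * rho f ^+ N) <= m)
  (d0P : forall y, I01 y -> d0 <= `|f u1 y - f u2 y|) (d0_ge0 : 0 <= d0)
  (pm1 : pm <= p u1) (pm2 : pm <= p u2)
  (P0 : 0 <= P) (P1 : P <= word_prob p t1) (P2 : P <= word_prob p t2)
  (q01 : 0 < q <= 1 / 2) (qd : 8 * q < m * (expR (- (3 * Ct + D)) * A^-1 * d0)).

Let kap : R := P * q ^+ 2 / 2.

Lemma cone_const_ge1 : 1 <= A.
Proof.
have := distortion_bound_ge0 hCt; have := pi_ge2 R.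
rewrite /A => h1 h2; have : 2 * 1 <= pi * (Ct + 1) by apply: ler_pM; lra.
lra.
Qed.

Lemma contraction_step (a b E : R) (k0 : nat) h H :
  1 <= `|b| -> `|a| <= 1 ->
  (forall (w : N.-tuple 'I_n) x, I01 x -> expR (2 * pi * a * cocycle f w x) <= E) ->
  `|b| * rho f ^+ k0 <= expR (- Ct) * A^-1 ->
  cone (A * `|b|) h H ->
  exists2 H' : R -> R, cone (A * `|b|) (iter N (transfer f p (Complex a b)) h) H' &
    forall M x, (k0 < M)%N -> I01 x ->
      iter M (walk f p) (fun y => H' y ^+ 2) x <=
      E ^+ 2 * (1 - kap * pm * expR (- 1)) * iter (M + N) (walk f p) (fun y => H y ^+ 2) x.
Proof.
move=> b1 a1 aE rk hH.
have C0 := distortion_bound_ge0 hCt; have A1 := cone_const_ge1.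
have pi2 := pi_ge2 R; have pi0 := pi_ge0 R; have r0 := rho_ge0 hf hCt hp.
have rN0 : 0 <= rho f ^+ N by rewrite exprn_ge0.
have A0 : 0 < A by lra.
have b0 : 0 < `|b| by lra.
have L0 : 0 <= A * `|b| by rewrite mulr_ge0// ltW.
have Lr : A * `|b| * rho f ^+ N <= A * `|b| * (1 / 4) by rewrite ler_wpM2l.
have AC : 16 * pi * Ct <= A.
  by rewrite /A ler_wpM2l ?mulr_ge0//; lra.
have [q0 q1] := andP q01.
have q2 : 0 < q ^+ 2 <= 1.
  by rewrite exprn_gt0// exprn_ile1 ?(ltW q0)//; lra.
have kap0 : 0 <= kap by apply: divr_ge0 (ler0n _ 2); apply: mulr_ge0 P0 (sqr_ge0 q).
pose H' := dolg f p t1 t2 (Complex a b) a h H.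
exists H'.
  apply: (dolg_cone hf hCt hp t12 L0 _ hH).
  have : 2 * pi * (`|a| + `|b|) * Ct <= A * `|b| / 4.
    apply: (@le_trans _ _ (2 * pi * (`|b| + `|b|) * Ct)).
      by rewrite ler_wpM2r// ler_wpM2l ?mulr_ge0// lerD2r; lra.
    have := ler_wpM2r (ltW b0) AC; lra.
  lra.
move=> M x kM Ix; rewrite iterD.
have Di1 : A^-1 <= 1 by rewrite invf_le1.
(* The parameters are beta = |b| and D1 = 1/A: the walk stops at the inverse of the cone constant,
   where phases still turn visibly but majorants are nearly constant. *)
apply: (iter_walk_gain hf hCt hp d0P d0_ge0 pm1 pm2 _ kap0 b0 _ _ _ _ _ _ rk kM Ix).
- by rewrite invr_gt0.
- exact: sqr_ge0.
- by lra.
- move=> y Iy; rewrite iter_walk sumr_ge0// => w _.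
  by rewrite mulr_ge0 ?sqr_ge0// ltW// (word_prob_gt0 hp).
- move=> y Iy; apply: (dolg_sqr_le hf hp t12 b hH Iy) => w; apply: aE; assumption.
- move=> x1 x2 I1 I2 /andP[dl du].
  have bA : A * (`|b| * `|x1 - x2|) <= 1.
    by rewrite mulrC -ler_pdivlMr// mul1r.
  have cb : 4 * pi * Ct * (`|b| * `|x1 - x2|) <= 1.
    apply: le_trans bA; rewrite ler_wpM2r ?mulr_ge0//.
    by apply: le_trans AC; rewrite ler_wpM2r// ler_wpM2r//; lra.
  have Lb : A * `|b| * rho f ^+ N * `|x1 - x2| <= 1 / 2.
    rewrite [leLHS](_ : _ = rho f ^+ N * (A * (`|b| * `|x1 - x2|))); last by ring.
    apply: (@le_trans _ _ (rho f ^+ N * 1)); first by rewrite ler_wpM2l.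
    by rewrite mulr1 (le_trans rN)//; lra.
  have rb : 16 * (A * `|b| * rho f ^+ N) <= m * `|b|.
    by rewrite [leLHS](_ : _ = 16 * (A * rho f ^+ N) * `|b|) ?ler_wpM2r//; ring.
  have qb : 8 * q < m * `|b| * `|x1 - x2|.
    by rewrite -mulrA (lt_le_trans qd)// ler_wpM2l// ltW.
  have [z zE [t tE lt]] := loss_large hf hCt hp a L0 hH I1 I2 (phase I1 I2) q01 cb Lb rb qb.
  exists z => //.
  have Iz : I01 z by case: zE => ->.
  have Pt : P <= word_prob p t by case: tE => ->.
  rewrite /kap; apply: (dolg_sqr_gain hf hp t12 hH Iz _ q2 Pt lt) => w; apply: aE; assumption.
- move=> x1 x2 I1 I2 bd.
  apply: (iter_walk_sqr_lip hf hCt hp (d := `|b|^-1 * A^-1) L0 hH I1 I2).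
    by rewrite mulrC ler_pdivlMr// mulrC.
  rewrite (_ : _ * _ = rho f ^+ N); first by apply: (le_trans rN); lra.
  by field; rewrite !gt_eqF.
Qed.

(** The waiting time is paid only once: block [k.+1] at walk time [M] calls on block [k] at time
    [M + N], which again exceeds [k0]. *)
Lemma contraction_iterate (a b E al : R) (k0 : nat) h :
  1 <= `|b| -> `|a| <= 1 ->
  (forall (w : N.-tuple 'I_n) x, I01 x -> expR (2 * pi * a * cocycle f w x) <= E) ->
  `|b| * rho f ^+ k0 <= expR (- Ct) * A^-1 ->
  (forall x, I01 x -> nc (h x) <= 1) ->
  (forall x y, I01 x -> I01 y -> nc (h x - h y) <= 2 * `|x - y|) ->
  0 <= al -> E ^+ 2 * (1 - kap * pm * expR (- 1)) <= al ->
  forall k, exists2 H : R -> R, cone (A * `|b|) (iter (k * N) (transfer f p (Complex a b)) h) H &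
    forall M x, (k == 0)%N || (k0 < M)%N -> I01 x ->
      iter M (walk f p) (fun y => H y ^+ 2) x <= al ^+ k.
Proof.
move=> b1 a1 aE rk h1 hl al0 Eal; have A1 := cone_const_ge1.
have L2 : 2 <= A * `|b|.
  have C0 := distortion_bound_ge0 hCt; have pi2 := pi_ge2 R.
  apply: (@le_trans _ _ (A * 1)); last by rewrite ler_wpM2l//; lra.
  rewrite mulr1 /A; have : 2 * 1 <= pi * (Ct + 1) by apply: ler_pM; lra.
  lra.
elim=> [|k [H Hc HM]].
  (* The constant majorant suits [h] because the cone constant is at least 2, and its mean is 1 at
     every time, without waiting. *)
  exists (fun=> 1).
    split => //= x y Ix Iy.
      rewrite mulr1 (le_trans (hl x y Ix Iy))//.
      have := expR_ge1Dx (A * `|b| * `|x - y|); have := ler_wpM2r (normr_ge0 (x - y)) L2.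
      by lra.
    rewrite subrr Normc.normc0 mulr1 subr_ge0 -[leLHS]expR0 ler_expR mulr_ge0//; lra.
  move=> M x _ Ix; rewrite iter_walk expr0 -[leRHS](sum_word_prob f hp M).
  by apply: ler_sum => w _; rewrite expr1n mulr1.
have [H' Hc' HM'] := contraction_step b1 a1 aE rk Hc.
exists H'; first by rewrite mulSn iterD.
move=> M x /= kM Ix; apply: (le_trans (HM' M x kM Ix)).
have s0 : 0 <= iter (M + N) (walk f p) (fun y => H y ^+ 2) x.
  rewrite iter_walk sumr_ge0// => w _.
  by rewrite mulr_ge0 ?sqr_ge0// ltW// (word_prob_gt0 hp).
apply: (le_trans (ler_wpM2r s0 Eal)); rewrite exprS ler_wpM2l//; apply: HM => //.
by rewrite (leq_trans kM) ?orbT// leq_addr.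
Qed.

(** The [k] blocks act on [h] first and the other [M] steps come last. These outer steps average the
    majorant, so that Jensen turns the mean-square bound into a pointwise one. They cost [Th ^+ M],
    that is, [(Th / al) ^+ M] relative to the rate [al]. *)
Lemma transfer_decay (a b Th al : R) (k0 : nat) h :
  (0 < N)%N -> 1 <= `|b| -> `|a| <= 1 -> 1 <= Th -> 0 < al <= 1 ->
  (forall w x, I01 x -> expR (2 * pi * a * cocycle f w x) <= Th ^+ size w) ->
  `|b| * rho f ^+ k0 <= expR (- Ct) * A^-1 ->
  (forall x, I01 x -> nc (h x) <= 1) ->
  (forall x y, I01 x -> I01 y -> nc (h x - h y) <= 2 * `|x - y|) ->
  (Th ^+ N) ^+ 2 * (1 - kap * pm * expR (- 1)) <= (al ^+ N) ^+ 2 ->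
  forall j x y, I01 x -> I01 y ->
    let B := (Th / al) ^+ (k0 + N).+1 * al ^+ j in
    let g := iter j (transfer f p (Complex a b)) h in
    nc (g x) <= B /\ nc (g x - g y) <= (expR (2 * (A * `|b|) * `|x - y|) - 1) * B.
Proof.
move=> N0 b1 a1 Th1 /andP[al0 al1] aTh rk h1 hl al2 j x y Ix Iy B.
have A1 := cone_const_ge1; have C0 := distortion_bound_ge0 hCt.
have pi0 := pi_ge0 R; have r0 := rho_ge0 hf hCt hp.
have L0 : 0 <= A * `|b| by rewrite mulr_ge0//; lra.
have [k [M [jE M1 M2]]] := split_steps j k0 N0.
have aE (w : N.-tuple 'I_n) z : I01 z -> expR (2 * pi * a * cocycle f w z) <= Th ^+ N.
  by move=> /(aTh w); rewrite size_tuple.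
have [H Hc HM] := contraction_iterate b1 a1 aE rk h1 hl (sqr_ge0 (al ^+ N)) al2 k.
have {}HM := HM M x M2 Ix.
set g := iter _ _ _; have gE z : I01 z -> g z = \sum_(w : M.-tuple 'I_n)
    brn f p (Complex a b) (iter (k * N) (transfer f p (Complex a b)) h) w z.
  by move=> Iz; rewrite /g jE iterD iter_transfer.
have ThA : 1 <= Th / al by rewrite ler_pdivlMr// mul1r (le_trans al1).
have SB : \sum_(w : M.-tuple 'I_n) amp f p a H w x <= B.
  have gw : iter M (walk f p) H x <= (al ^+ N) ^+ k.
    have : iter M (walk f p) H x ^+ 2 <= ((al ^+ N) ^+ k) ^+ 2.
      rewrite [leRHS]exprAC; exact: le_trans (iter_walk_sqr f hp M H x) HM.
    rewrite ler_sqr ?nnegrE ?exprn_ge0 ?(ltW al0)//.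
    rewrite iter_walk sumr_ge0// => w _; rewrite mulr_ge0 ?(ltW (word_prob_gt0 hp _))//.
    by case: Hc => /(_ _ (word_map_I01 hf w Ix))/ltW.
  apply: (@le_trans _ _ (Th ^+ M * (al ^+ N) ^+ k)).
    apply: le_trans (ler_wpM2l (exprn_ge0 M (le_trans ler01 Th1)) gw).
    rewrite iter_walk mulr_sumr; apply: ler_sum => w _.
    rewrite /amp mulrAC [leRHS]mulrC ler_wpM2l//.
      rewrite mulr_ge0 ?(ltW (word_prob_gt0 hp _))//.
      by case: Hc => /(_ _ (word_map_I01 hf w Ix))/ltW.
    by have := aTh w _ Ix; rewrite size_tuple.
  apply: (@le_trans _ _ ((Th / al) ^+ M * al ^+ j)).
    rewrite {1}jE exprD mulrA -exprMn divfK ?gt_eqF// mulnC exprM.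
    by [].
  by rewrite ler_wpM2r ?exprn_ge0 ?(ltW al0)// ler_weXn2l.
have B0 : 0 <= B by rewrite mulr_ge0 ?exprn_ge0 ?(ltW al0)//; lra.
split.
  rewrite gE//; apply: (le_trans (nc_sum _ _)); apply: le_trans SB.
  by apply: ler_sum => w _; exact: (brn_le hf hp a b w Hc Ix).
rewrite !gE//.
(* [M] may be 0, in which case the cone constant is not contracted; one copy of A|b| is kept for the
   majorant and another for the phases. *)
have LL (w : M.-tuple 'I_n) : explip (2 * (A * `|b|))
    (brn f p (Complex a b) (iter (k * N) (transfer f p (Complex a b)) h) w) (amp f p a H w).
  case: (Hc) => _ Hc2 Hc3 _.
  apply: explip_le (brn_explip hf hCt hp a b w L0 Hc2 Hc3); last first.
    by move=> z Iz; exact: ltW (amp_gt0 hf hp a w Hc Iz).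
  have e1 : A * `|b| * rho f ^+ size w <= A * `|b|.
    by rewrite ler_piMr// exprn_ile1// ltW// (rho_lt1 hf).
  have e2 : 2 * pi * (`|a| + `|b|) * Ct <= A * `|b|.
    apply: (@le_trans _ _ (2 * pi * (`|b| + `|b|) * (Ct + 1))).
      apply: ler_pM => //; first by rewrite !mulr_ge0// addr_ge0.
        by rewrite ler_wpM2l ?mulr_ge0// lerD2r (le_trans a1).
      by lra.
    have : 0 <= pi * (Ct + 1) * `|b| by rewrite !mulr_ge0//; lra.
    rewrite /A; lra.
  lra.
apply: le_trans (explip_sum predT LL Ix Iy) _.
rewrite ler_wpM2l// subr_ge0 -[leLHS]expR0 ler_expR !mulr_ge0//; lra.
Qed.

End Iteration.

(** * Passage to the C^1 norm and counting of steps *)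

Section Norms.
Variable R : realType.

Lemma C1_norm_le1 (h : R -> R[i]) : C1c h -> (C1_norm h <= 1)%E ->
  (forall x, I01 x -> nc (h x) <= 1) /\
  (forall x y, I01 x -> I01 y -> nc (h x - h y) <= 2 * `|x - y|).
Proof.
move=> [[hr _] [hi _]] h1.
have I0 : I01 (0 : R) by rewrite /I01 /= in_itv /= lexx ler01.
have s0 (g : R -> R[i]) : (0 <= sup_norm g)%E.
  by apply: (@le_trans _ _ (nc (g 0))%:E); [rewrite lee_fin nc_ge0|apply: ereal_sup_ubound; exists 0].
have sU (g : R -> R[i]) x : I01 x -> (sup_norm g <= 1)%E -> nc (g x) <= 1.
  by move=> Ix g1; rewrite -lee_fin (le_trans _ g1)//; apply: ereal_sup_ubound; exists x.
have hs : (sup_norm h <= 1)%E by rewrite (le_trans _ h1)// leeDl.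
have ds : (sup_norm (D01c h) <= 1)%E by rewrite (le_trans _ h1)// leeDr.
have lip (g : R -> R) : {in I01, forall x, derivable01 g x} ->
    (forall x, I01 x -> `|D01 g x| <= 1) ->
    forall x y, I01 x -> I01 y -> `|g x - g y| <= `|x - y|.
  move=> dg g1 x y Ix Iy; have [|z Iz ->] := @MVT_D01 R g _ y x Iy Ix.
    by move=> z Iz; exists (D01 g z); apply/derivable01_hasD/dg; rewrite inE.
  by rewrite normrM ler_piMl// g1.
split=> [x Ix|x y Ix Iy]; first exact: sU.
apply: (le_trans (nc_le_ReIm _)).
have -> : complex.Re (h x - h y) = ReF h x - ReF h y by rewrite /ReF; case: (h x) (h y) => ? ? [].
have -> : complex.Im (h x - h y) = ImF h x - ImF h y by rewrite /ImF; case: (h x) (h y) => ? ? [].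
rewrite mulr2n mulrDl mul1r; apply: lerD; apply: lip => // z Iz.
  exact: le_trans (norm_Re_le (D01c h z)) (sU _ _ Iz ds).
exact: le_trans (norm_Im_le (D01c h z)) (sU _ _ Iz ds).
Qed.

(** Within distance 1/(2L) the exponential bound is linear with slope 2LB, which bounds [D01] of the
    real and of the imaginary part; the two together give 4LB. *)
Lemma C1_norm_le_explip (g : R -> R[i]) (B L : R) : 0 <= B -> 0 < L ->
  (forall x y, I01 x -> I01 y -> nc (g x) <= B /\
    nc (g x - g y) <= (expR (L * `|x - y|) - 1) * B) ->
  (C1_norm g <= ((1 + 4 * L) * B)%:E)%E.
Proof.
move=> B0 L0 H; rewrite mulrDl mul1r EFinD; apply: leeD.
  by apply: ge_ereal_sup => _ [x Ix <-]; rewrite lee_fin; case: (H x x Ix Ix).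
apply: ge_ereal_sup => _ [x Ix <-]; rewrite lee_fin.
have lip (k : R -> R) : (forall y, I01 y -> `|k y - k x| <= nc (g x - g y)) ->
    `|D01 k x| <= 2 * L * B.
  move=> kg; apply: (@D01_le_lipschitz _ _ _ _ (2 * L)^-1) => //.
  - by rewrite invr_gt0 mulr_gt0.
  - by rewrite !mulr_ge0// ltW.
  - move=> y Iy xy; apply: (le_trans (kg y Iy)); case: (H x y Ix Iy) => _ /le_trans; apply.
    rewrite mulrAC ler_wpM2r// distrC lerBlDl -mulrA; apply: expR_le1D2x.
    rewrite mulr_ge0 ?(ltW L0)//= mulrC -ler_pdivlMr//.
    by apply: ltW; apply: (lt_le_trans xy); rewrite invfM mul1r.
apply: (le_trans (nc_le_ReIm _)); rewrite (_ : 4 * L * B = 2 * L * B + 2 * L * B); last by ring.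
apply: lerD; apply: lip => y Iy; rewrite ncB_sym.
  by apply: le_trans (norm_Re_le _); rewrite /ReF; case: (g x) (g y) => ? ? [].
by apply: le_trans (norm_Im_le _); rewrite /ImF; case: (g x) (g y) => ? ? [].
Qed.

Lemma pow_small (r e : R) : 0 <= r -> r < 1 -> 0 < e -> exists k : nat, r ^+ k <= e.
Proof.
move=> r0 r1 e0; have : (r ^+ k @[k --> \oo] --> (0 : R)).
  by apply: cvg_expr; rewrite ger0_norm.
move=> /cvgrPdist_le/(_ e e0)[k _ /(_ k (leqnn k))] /=.
by rewrite sub0r normrN ger0_norm ?exprn_ge0// => ?; exists k.
Qed.

(** The least [k] with [t * r ^+ k <= c] is of order log t, so [th ^+ k] is at most polynomial in
    [t]. *)
Lemma scale_count (r th c : R) : 0 <= r < 1 -> 1 <= th -> 0 < c ->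
  exists (gam : nat) (C : R), 0 < C /\
    forall t, 1 <= t -> exists2 k : nat, t * r ^+ k <= c & th ^+ k <= C * t ^+ gam.+1.
Proof.
move=> /andP[r0 r1] th1 c0.
have small := pow_small r0 r1.
have th0 : 0 < th by lra.
have ti : 0 < th^-1 by rewrite invr_gt0.
have [gam ge] := small _ ti.
(* One more power of [r] is harmless and makes the exponent positive, as [gamma] has to be. *)
have {}ge : th * r ^+ gam.+1 <= 1.
  rewrite mulrC -ler_pdivlMr// mul1r (le_trans _ ge)// exprS ler_piMl ?exprn_ge0//.
  exact: ltW.
pose d := Num.max 1 c^-1.
have d1 : 1 <= d by rewrite le_max lexx.
have dc : c^-1 <= d by rewrite le_max lexx orbT.
have d0 : 0 < d by lra.
exists gam, (th * d ^+ gam.+1); split; first by rewrite mulr_gt0// exprn_gt0.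
move=> t t1; have t0 : 0 < t by lra.
have ex : exists k, t * r ^+ k <= c.
  have [k kc] := small _ (divr_gt0 c0 t0); exists k.
  by rewrite mulrC -ler_pdivlMr.
case: (ex_minnP ex) => k kc kmin; exists k => //.
case: k kc kmin => [|k] kc kmin.
  rewrite expr0 -[leLHS]mulr1 ler_pM ?exprn_ege1// -[leLHS]mulr1.
  by rewrite ler_pM ?exprn_ege1.
have {}kmin : c < t * r ^+ k.
  by rewrite ltNge; apply/negP => /kmin; rewrite ltnn.
rewrite exprS -mulrA ler_wpM2l ?(ltW th0)// -exprMn.
(* By minimality the inserted factor is at least 1; its powers of [r] then cancel those of [th]. *)
apply: (@le_trans _ _ (th ^+ k * (t * r ^+ k / c) ^+ gam.+1)).
  rewrite ler_peMr ?exprn_ge0 ?(ltW th0)// exprn_ege1//.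
  by rewrite ler_pdivlMr// mul1r ltW.
have -> : th ^+ k * (t * r ^+ k / c) ^+ gam.+1 = (th * r ^+ gam.+1) ^+ k * (t / c) ^+ gam.+1.
  by rewrite mulrAC !exprMn -!exprM [(gam.+1 * k)%N]mulnC; ring.
apply: (@le_trans _ _ (1 * (t / c) ^+ gam.+1)).
  rewrite ler_wpM2r ?exprn_ge0 ?divr_ge0 ?(ltW t0) ?(ltW c0)//.
  by rewrite exprn_ile1// mulr_ge0 ?exprn_ge0// ltW.
rewrite mul1r lerXn2r ?nnegrE ?divr_ge0 ?mulr_ge0 ?(ltW t0) ?(ltW c0) ?(ltW d0)//.
by rewrite [leRHS]mulrC ler_wpM2l ?(ltW t0).
Qed.
End Norms.

(** * Quantitative consequences of (S) and (U) *)

Section Geometry.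
Variables (R : realType) (n : nat) (f : 'I_n -> R -> R) (Ct : R).
Hypotheses (hf : is_C2_IFS f) (hCt : distortion_bound f Ct).

(** By compactness the distance attains its minimum, which is positive since the two images never
    meet. *)
Lemma disjoint_images_gap (k l : 'I_n) : disjoint_images f k l ->
  exists2 d : R, 0 < d & forall y, I01 y -> d <= `|f k y - f l y|.
Proof.
move=> kl; have gc : {within `[0, 1], continuous (fun y : R => `|f k y - f l y|)}.
  apply/subspace_continuousP => z zI; apply: cvg_norm; apply/cvgrPdist_le => e e0.
  have [d d0 Hd] := hasD_continuous (hasDB (branch_hasD hf k zI) (branch_hasD hf l zI)) e0.
  rewrite near_withinE; apply/nbhs_ballP; exists d => // w; rewrite /ball /= => wd wI.
  by rewrite distrC; apply: Hd => //; rewrite distrC.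
have [c cI cmin] := EVT_min ler01 gc.
exists `|f k c - f l c|; last by move=> y yI; exact: cmin.
rewrite normr_gt0 subr_eq0; apply/negP => /eqP e.
have : (f k @` I01 `&` f l @` I01) (f k c) by split; exists c.
by rewrite kl.
Qed.

(** The words share the outer part [w] and differ in the letter applied first. By the chain rule the
    phase is the difference in (U) plus two cocycles of [w] evaluated after one contraction; each is
    Lipschitz with constant [Ct * rho f], whence the term [2 * Ct * rho f]. *)
Lemma phase_lower (m : R) (w : seq 'I_n) (k l : 'I_n) :
  (forall x, I01 x -> m <= `|D01 (fun y => log_deriv (f k) y - log_deriv (f l) y) x|) ->
  forall x y, I01 x -> I01 y -> (m - 2 * Ct * rho f) * `|x - y| <=
    `|(cocycle f (rcons w k) x - cocycle f (rcons w l) x)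
      - (cocycle f (rcons w k) y - cocycle f (rcons w l) y)|.
Proof.
move=> mD x y Ix Iy.
have cE (j : 'I_n) z : I01 z ->
    cocycle f (rcons w j) z = - log_deriv (f j) z + cocycle f w (f j z).
  by move=> Iz; rewrite -cats1 (cocycle_cat hf).
rewrite !cE//.
have lip (j : 'I_n) : `|cocycle f w (f j x) - cocycle f w (f j y)| <= Ct * rho f * `|x - y|.
  apply: le_trans (cocycle_lip hf hCt w (branch_I01 hf j Ix) (branch_I01 hf j Iy)) _.
  rewrite -mulrA ler_wpM2l ?(distortion_bound_ge0 hCt)//; exact: (branch_contract hf hCt).
have hD z : I01 z -> exists r, hasD I01 (fun y => log_deriv (f k) y - log_deriv (f l) y) z r.
  move=> Iz; have [r1 h1] := log_deriv_hasD hf [:: k] Iz.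
  by have [r2 h2] := log_deriv_hasD hf [:: l] Iz; exists (r1 - r2); exact: hasDB.
have [z Iz zE] := MVT_D01 hD Iy Ix.
have : m * `|x - y| <= `|(log_deriv (f k) x - log_deriv (f l) x)
     - (log_deriv (f k) y - log_deriv (f l) y)|.
  by rewrite zE normrM ler_wpM2r// mD.
move: (lip k) (lip l).
move: (log_deriv (f k) x) (log_deriv (f l) x) (log_deriv (f k) y) (log_deriv (f l) y).
move: (cocycle _ _ (f k x)) (cocycle _ _ (f k y)) (cocycle _ _ (f l x)) (cocycle _ _ (f l y)).
move=> c1 c2 c3 c4 l1 l2 l3 l4 h1 h2 h3.
have -> : - l1 + c1 - (- l2 + c3) - (- l3 + c2 - (- l4 + c4)) =
  - ((l1 - l2 - (l3 - l4)) - ((c1 - c2) - (c3 - c4))) by ring.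
rewrite normrN (le_trans _ (lerB_dist _ _))//.
have := ler_normB (c1 - c2) (c3 - c4).
by move: (`|x - y|) (rho f) h1 h2 h3 (ler_normB (c1 - c2) (c3 - c4)) => d r h1 h2 h3 h; lra.
Qed.
End Geometry.

(** * Choice of the words and constants *)

Lemma val_letter n (hn : (4 <= n)%N) i : (i < 4)%N -> letter hn i = i :> nat.
Proof. by move=> i4; rewrite /= inordK. Qed.

Theorem theorem2p8 (R : realType) (n : nat) (hn : (4 <= n)%N)
    (f : 'I_n -> R -> R) (hf : is_C2_IFS f)
    (K : set R) (hK : is_attractor f K) (hK0 : ~ K 0) (hK1 : ~ K 1)
    (Ct : R) (hCt : distortion_bound f Ct)
    (hS : separation hn f) (hU : non_integrability hn f Ct)
    (p : 'I_n -> R) (hp : positive_prob_vector p)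
    (nu : probability (measurableTypeR R) R) (hnu : self_conformal f p nu) :
  exists C gamma epsilon B alpha : R,
    [/\ 0 < C, 0 < gamma, 0 < epsilon, 0 < B & 0 < alpha < 1] /\
    forall (b a : R) (k : nat), B < `|b| -> `|a| < epsilon ->
      (C1_opnorm (iter k (transfer f p (Complex a b)))
         <= (C * `|b| `^ (1 + gamma) * alpha ^+ k)%:E)%E.
Proof.
have [m' [M' [m'0 _ hD rest]]] := hU.
have r0 : 0 <= rho f := rho_ge0 hf hCt hp.
have r1 : rho f < 1 := rho_lt1 hf.
have C0 := distortion_bound_ge0 hCt.
have I0 : I01 (0 : R) by rewrite /I01 /= in_itv /= lexx ler01.
pose l0 := letter hn 0; pose l1 := letter hn 1.
have l01 : l1 != l0 by rewrite -val_eqE [val l1](val_letter hn (isT : (1 < 4)%N)) [val l0](val_letter hn (isT : (0 < 4)%N)).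
(* The disjoint pair provided by (S) separates the two points reached by the walk. *)
have [i iE [dis _ _]] := hS l0.
have [d0 d0_gt0 d0P] := disjoint_images_gap hf dis.
set u1 := letter hn i in d0P; set u2 := letter hn i.+1 in d0P.
set m := m' - 2 * Ct * rho f in rest.
pose A := 16 * pi * (Ct + 1).
have A1 : 1 <= A := cone_const_ge1 hCt.
have A0 : 0 < A by lra.
pose D := - ln (inf (deriv_values f)).
have D0 : 0 <= D.
  have := cocycle_le hf [:: l0] I0; have := cocycle_ge0 hf hCt [:: l0] I0.
  by rewrite /D mulr1; exact: le_trans.
have p0 a : 0 < p a by case: hp.
(* The bound 1/4 preserves the cone; m/(16A) makes h/H move slowly compared with the turning of the
   phase. *)
have [N' N'P] : exists N' : nat, rho f ^+ N' <= Num.min (1 / 4) (m / (16 * A)).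
  apply: (pow_small r0 r1); rewrite lt_min; apply/andP.
  by split; apply: divr_gt0 => //; apply: mulr_gt0.
pose N := N'.+1.
have rN : rho f ^+ N <= Num.min (1 / 4) (m / (16 * A)).
  by rewrite (le_trans _ N'P)// exprS ler_piMl ?exprn_ge0// ltW.
have {N'P}[rN4 rNm] : rho f ^+ N <= 1 / 4 /\ 16 * (A * rho f ^+ N) <= m.
  move: rN; rewrite le_min => /andP[-> h]; split => //.
  have A16 : 0 < 16 * A by apply: mulr_gt0.
  by rewrite mulrA mulrC -(ler_pdivlMr _ _ A16).
(* The last letter of a word is applied first, so [t1] and [t2] have a common outer part and differ
   only in the innermost map. *)
pose t1 : N.-tuple 'I_n := [tuple of rcons (nseq N' l0) l0].
pose t2 : N.-tuple 'I_n := [tuple of rcons (nseq N' l0) l1].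
have t12 : t2 != t1.
  apply: contra_neq l01 => e.
  have /rcons_inj : rcons (nseq N' l0) l1 = rcons (nseq N' l0) l0 := congr1 val e.
  exact: (congr1 snd).
have phase x y : I01 x -> I01 y -> m * `|x - y| <=
    `|(cocycle f t1 x - cocycle f t2 x) - (cocycle f t1 y - cocycle f t2 y)|.
  apply: (phase_lower hf hCt) => z Iz.
  by have /andP[] := hD 0%N z (or_introl erefl) Iz.
pose P := Num.min (word_prob p t1) (word_prob p t2).
have P0 : 0 < P by rewrite lt_min !(word_prob_gt0 hp).
have P1 : P <= word_prob p t1 by rewrite ge_min lexx.
have P2 : P <= word_prob p t2 by rewrite ge_min lexx orbT.
pose pm := Num.min (p u1) (p u2).
have pm0 : 0 < pm by rewrite lt_min !p0.
have pm1 : pm <= p u1 by rewrite ge_min lexx.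
have pm2 : pm <= p u2 by rewrite ge_min lexx orbT.
(* [g] bounds from below the turning m|b||x - y| at the separation guaranteed by the walk; [q] must
   satisfy 8q < g. *)
pose g := m * (expR (- (3 * Ct + D)) * A^-1 * d0).
have g0 : 0 < g by rewrite !mulr_gt0 ?expR_gt0 ?invr_gt0.
pose q := Num.min (1 / 2) (g / 16).
have q0 : 0 < q <= 1 / 2.
  by rewrite ge_min lexx lt_min !divr_gt0.
have qg : 8 * q < g.
  have : q <= g / 16 by rewrite ge_min lexx orbT.
  by move: g0; move: (g) (q) => u v; lra.
pose kap := P * q ^+ 2 / 2 * pm * expR (-1).
have kap0 : 0 < kap.
  case/andP: q0 => q0 _.
  by rewrite !mulr_gt0 ?expR_gt0 ?exprn_gt0// invr_gt0.
(* [ep] is so small that the perturbation [a] costs at most exp(kap/2) in a squared block, against a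
   gain 1 - kap <= exp(-kap). The surplus exp(-kap/2) is [al] to the power 2N. *)
pose den := 8 * pi * (D + 1) * N%:R.
have den0 : 0 < den by rewrite /den !mulr_gt0 ?pi_gt0 ?ltr0n//; lra.
pose ep := Num.min 1 (kap / den).
have ep0 : 0 < ep by rewrite lt_min ltr01 divr_gt0.
have ep1 : ep <= 1 by rewrite ge_min lexx.
have epd : ep * den <= kap by rewrite -ler_pdivlMr// ge_min lexx orbT.
pose Th := expR (2 * pi * ep * D).
pose al := expR (- (kap / (4 * N%:R))).
have N0 : 0 < N%:R :> R by rewrite ltr0n.
have Th1 : 1 <= Th.
  by rewrite -[leLHS]expR0 ler_expR mulr_ge0// mulr_ge0 ?(ltW ep0)// mulr_ge0 ?pi_ge0.
have al01 : 0 < al < 1.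
  by rewrite expR_gt0 -[ltRHS]expR0 ltr_expR oppr_lt0 divr_gt0// mulr_gt0.
have [al0 al1] := andP al01.
have contr : (Th ^+ N) ^+ 2 * (1 - kap) <= (al ^+ N) ^+ 2.
  rewrite -!exprM /Th /al -!expRM_natl.
  apply: (@le_trans _ _ (expR ((N * 2)%:R * (2 * pi * ep * D)) * expR (- kap))).
    by rewrite ler_wpM2l ?expR_ge0//; have := expR_ge1Dx (- kap); lra.
  rewrite -expRD ler_expR natrM.
  have -> : N%:R * 2 * - (kap / (4 * N%:R)) = - (kap / 2) by field; rewrite gt_eqF.
  have -> : N%:R * 2 * (2 * pi * ep * D) = ep * (8 * pi * D * N%:R) / 2 by field.
  have : ep * (8 * pi * D * N%:R) <= ep * den.
    rewrite ler_wpM2l ?(ltW ep0)// /den ler_wpM2r ?(ltW N0)// ler_wpM2l ?mulr_ge0 ?pi_ge0//.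
    by lra.
  by move: epd; move: (ep * den) (ep * _) => u v; lra.
have ThA : 1 <= Th / al by rewrite ler_pdivlMr// mul1r (le_trans (ltW al1)).
have c0 : 0 < expR (- Ct) * A^-1 by rewrite mulr_gt0 ?expR_gt0// invr_gt0.
have r01 : 0 <= rho f < 1 by rewrite r0.
have [gam [C [C0' scale]]] := scale_count r01 ThA c0.
pose W := (Th / al) ^+ N.+1.
have W0 : 0 < W by rewrite exprn_gt0//; lra.
(* [9 * A] comes from the derivative bound 1 + 8A|b|, [W] from the fixed [N.+1] outer steps and [C]
   from the [k0] waiting steps. The derivative contributes one power of |b|, the waiting time the
   other [gam.+1]. *)
exists (9 * A * W * C), (gam.+1%:R), ep, 1, al; split.
  by split => //; do 3! apply: mulr_gt0 => //.
move=> b a k b1 aep.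
have [k0 rk Thk] := scale `|b| (ltW b1).
apply: ge_ereal_sup => _ [h [hC h1] <-].
have [hb hl] := C1_norm_le1 hC h1.
have aTh (w : seq 'I_n) x : I01 x -> expR (2 * pi * a * cocycle f w x) <= Th ^+ size w.
  move=> Ix; rewrite /Th -expRM_natl ler_expR.
  have c1 := cocycle_le hf w Ix; have c2 := cocycle_ge0 hf hCt w Ix.
  move: c1 c2; rewrite -/D; move: (cocycle f w x) => c c1 c2.
  have -> : 2 * pi * a * c = 2 * pi * (a * c) by ring.
  have -> : (size w)%:R * (2 * pi * ep * D) = 2 * pi * (ep * (D * (size w)%:R)) by ring.
  rewrite ler_wpM2l ?mulr_ge0 ?pi_ge0//.
  apply: (@le_trans _ _ (`|a| * c)); first by rewrite ler_wpM2r// ler_norm.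
  by rewrite ler_pM// ltW.
have a1 : `|a| <= 1 by rewrite (le_trans (ltW aep)).
have al01' : 0 < al <= 1 by rewrite al0 ltW.
have dec := transfer_decay hf hCt hp t12 rest phase rN4 rNm d0P (ltW d0_gt0) pm1 pm2
  (ltW P0) P1 P2 q0 qg (ltn0Sn N') (ltW b1) a1 Th1 al01' aTh rk hb hl contr k.
have B0 : 0 <= (Th / al) ^+ (k0 + N).+1 * al ^+ k.
  by rewrite mulr_ge0 ?exprn_ge0 ?(ltW al0)//; lra.
have bpos : 0 < `|b| by lra.
have L0 : 0 < 2 * (A * `|b|) by do 2! apply: mulr_gt0 => //.
apply: le_trans (C1_norm_le_explip B0 L0 dec) _.
rewrite lee_fin nat1r powR_mulrn//.
have kb : 1 + 4 * (2 * (A * `|b|)) <= 9 * A * `|b|.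
  have Ab : 1 <= A * `|b| := mulr_ege1 A1 (ltW b1).
  by rewrite -[9 * A * _]mulrA; move: (A * _) Ab => u Ab; lra.
apply: le_trans (ler_wpM2r B0 kb) _.
rewrite [leRHS](_ : _ = 9 * A * `|b| * (C * `|b| ^+ gam.+1 * W * al ^+ k)); last first.
  by rewrite exprS; ring.
apply: ler_wpM2l; first by apply: mulr_ge0 => //; apply: mulr_ge0 => //; exact: ltW.
rewrite -addnS exprD -/W; apply: ler_wpM2r; first by rewrite exprn_ge0// ltW.
by apply: ler_wpM2r Thk; exact: ltW.
Qed.
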